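(* Let $T_{rg}$ be the first-order theory of the random graph. Then $T_{rg}\trianglelefteq T$ for every unstable metric theory $T$.
   Context: $T_{rg}$ is the complete first-order theory, in a vocabulary with one binary relation $R$, saying that $R$ is symmetric and irreflexive and that for any two disjoint finite sets $X,Y$ there is $z$ with $R(z,x)$ for all $x\in X$ and $\neg R(z,y)$ for all $y\in Y$. First-order structures are regarded as metric structures with the discrete metric ($d(x,y)=0$ iff $x=y$, else $1$) and $\{0,1\}$-valued predicates. Metric structures: a vocabulary $V$ is a countable set of symbols; a metric structure is a real-valued $V$-structure (predicates in $[0,1]$) with a distinguished binary predicate $d$ interpreted as a complete metric, all symbols uniformly continuous with prescribed moduli. Continuous formulas use continuous connectives and quantifiers $\sup,\inf$; value $0$ means truth. A metric theory is the set of sentences with value $0$ in some metric structure. A structure is $\kappa$-saturated if every finitely satisfiable set of formulas with parameters from fewer than $\kappa$ elements is satisfiable. $\mathcal D$ over $I$, $|I|=\lambda$ infinite, is regular if some $\mathcal X\subseteq\mathcal D$ of size $\lambda$ has each $t\in I$ in only finitely many members; $\mathrm{Sat}(T)$ is the class of regular $\mathcal D$ such that the ultrapower $\mathcal M_{\mathcal D}$ is $\lambda^+$-saturated for every model $\mathcal M$ of $T$; $S\trianglelefteq T$ means $\mathrm{Sat}(T)\subseteq\mathrm{Sat}(S)$. A formula $\varphi(\vec x,\vec y)$ is unstable in $T$ if there are $0\le s<r\le1$, a model and $\langle\vec a_h,\vec b_h\rangle_{h\in\mathbb N}$ with $\varphi(\vec a_h,\vec b_k)\le s$ and $\varphi(\vec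 a_k,\vec b_h)\ge r$ for $h<k$; $T$ is unstable if some formula is unstable in $T$. *)

(* Defs.v *)
From HB Require Import structures.
From mathcomp Require Import all_boot all_order all_algebra.
From mathcomp Require Import all_classical all_reals all_analysis.

Set Implicit Arguments.
Unset Strict Implicit.
Unset Printing Implicit Defensive.

Import Order.TTheory GRing.Theory Num.Theory.
Import numFieldNormedType.Exports.

Local Open Scope classical_set_scope.
Local Open Scope card_scope.
Local Open Scope ring_scope.

(* A countable vocabulary with prescribed moduli of uniform continuity.  The
   distinguished predicate d is not listed in [psym]: it is present in every
   vocabulary, and any metric satisfies |d(x,y) - d(x',y')| <= 2 e as soon as
   d(x,x') <= e and d(y,y') <= e, so it needs no modulus.  Constants are the
   function symbols of arity 0. *)
Record vocabulary (R : realType) := Vocabulary {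
  psym : countType;
  par : psym -> nat;
  pmod : psym -> R -> R;
  pmod_gt0 : forall p e, 0 < e -> 0 < pmod p e;
  fsym : countType;
  far : fsym -> nat;
  fmod : fsym -> R -> R;
  fmod_gt0 : forall f e, 0 < e -> 0 < fmod f e }.

Record structure (R : realType) (V : vocabulary R) := Structure {
  carrier :> Type;
  carrier_inhabited : inhabited carrier;
  pint : forall p : psym V, ('I_(par p) -> carrier) -> R;
  pint01 : forall p a, 0 <= pint (p := p) a <= 1;
  fint : forall f : fsym V, ('I_(far f) -> carrier) -> carrier;
  dist : carrier -> carrier -> R;
  dist01 : forall x y, 0 <= dist x y <= 1 }.
Arguments pint {R V} s p a.
Arguments fint {R V} s f a.
Arguments dist {R V s} x y.

Section MetricStructure.
Context {R : realType} {V : vocabulary R} (M : structure V).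

Definition is_metric : Prop :=
  [/\ forall x y : M, dist x y = 0 <-> x = y,
      forall x y : M, dist x y = dist y x
    & forall x y z : M, dist x z <= dist x y + dist y z].

Definition is_complete : Prop :=
  forall u : nat -> M,
    (forall e : R, 0 < e ->
       exists N, forall m n, (N <= m)%N -> (N <= n)%N ->
         dist (u m) (u n) < e) ->
    exists l : M, forall e : R, 0 < e ->
      exists N, forall n, (N <= n)%N -> dist (u n) l < e.

Definition respects_moduli : Prop :=
  (forall (p : psym V) (e : R) (a b : 'I_(par p) -> M), 0 < e ->
     (forall i, dist (a i) (b i) < pmod p e) ->
     `|pint M p a - pint M p b| <= e) /\
  (forall (f : fsym V) (e : R) (a b : 'I_(far f) -> M), 0 < e ->
     (forall i, dist (a i) (b i) < fmod f e) ->
     dist (fint M f a) (fint M f b) <= e).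

Definition metric_structure : Prop :=
  [/\ is_metric, is_complete & respects_moduli].

End MetricStructure.

Definition unit_cube (R : realType) (n : nat) : set 'rV[R]_n :=
  [set x | forall i, 0 <= x ord0 i <= 1].

Record connective (R : realType) (n : nat) := Connective {
  cfun :> 'rV[R]_n -> R;
  cfun_continuous : {within @unit_cube R n, continuous cfun};
  cfun01 : forall x, unit_cube x -> 0 <= cfun x <= 1 }.

Section Formulas.
Context {R : realType} (V : vocabulary R).

Inductive term :=
  | Var of nat
  | App (f : fsym V) of ('I_(far f) -> term).

Inductive formula :=
  | Pred (p : psym V) of ('I_(par p) -> term)
  | Dist of term & term
  | Conn (n : nat) of connective R n & ('I_n -> formula)
  | Sup of nat & formula
  | Inf of nat & formula.

Fixpoint term_vars (t : term) : set nat :=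
  match t with
  | Var x => [set x]
  | App _ ts => \bigcup_i term_vars (ts i)
  end.

Fixpoint free_vars (phi : formula) : set nat :=
  match phi with
  | Pred _ ts => \bigcup_i term_vars (ts i)
  | Dist t u => term_vars t `|` term_vars u
  | Conn _ _ phis => \bigcup_i free_vars (phis i)
  | Sup x psi | Inf x psi => free_vars psi `\ x
  end.

Definition sentence (phi : formula) : Prop := free_vars phi = set0.

End Formulas.

Section Semantics.
Context {R : realType} {V : vocabulary R} (M : structure V).

Definition update (v : nat -> M) (x : nat) (a : M) : nat -> M :=
  fun y => if y == x then a else v y.

Fixpoint term_val (v : nat -> M) (t : term V) : M :=
  match t with
  | Var x => v x
  | App f ts => fint M f (fun i => term_val v (ts i))
  end.

Fixpoint value (v : nat -> M) (phi : formula V) : R :=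
  match phi with
  | Pred p ts => pint M p (fun i => term_val v (ts i))
  | Dist t u => dist (term_val v t) (term_val v u)
  | Conn n c phis => c (\row_i value v (phis i))
  | Sup x psi => sup [set value (update v x a) psi | a in [set: M]]
  | Inf x psi => inf [set value (update v x a) psi | a in [set: M]]
  end.

(* For a sentence the value does not depend on the valuation. *)
Definition holds (phi : formula V) : Prop := forall v, value v phi = 0.

End Semantics.

Section Theories.
Context {R : realType} {V : vocabulary R}.

Definition theory_of (M : structure V) : set (formula V) :=
  [set phi | sentence phi /\ holds M phi].

Definition metric_theory (T : set (formula V)) : Prop :=
  exists M : structure V, metric_structure M /\ T = theory_of M.

Definition model (T : set (formula V)) (M : structure V) : Prop :=
  metric_structure M /\ forall phi, T phi -> holds M phi.

(* [xs] lists the variables of the block x; the remaining free variables of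
   [phi] form the block y.  The tuples a_h and b_h are the restrictions of the
   valuations [a h] and [b h] to the respective blocks. *)
Definition unstable_formula (T : set (formula V)) (phi : formula V)
    (xs : seq nat) : Prop :=
  exists s r : R, [/\ 0 <= s, s < r, r <= 1 &
    exists M : structure V, model T M /\
    exists a b : nat -> nat -> M,
      let val h k := value (fun x => if x \in xs then a h x else b k x) phi in
      forall h k, (h < k)%N -> val h k <= s /\ r <= val k h].

Definition unstable (T : set (formula V)) : Prop :=
  exists phi xs, unstable_formula T phi xs.

End Theories.

Section Saturation.
Context {R : realType} {V : vocabulary R} (M : structure V).

(* A formula with parameters is a pair [(phi, rho)]: each free variable x of
   [phi] with [rho x = Some a] is replaced by the parameter a. *)
Definition pformula : Type := (formula V * (nat -> option M))%type.

Definition pformula_over (A : set M) (q : pformula) : Prop :=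
  forall x a, q.2 x = Some a -> A a.

Definition pvalue (v : nat -> M) (q : pformula) : R :=
  value (fun x => odflt (v x) (q.2 x)) q.1.

Definition satisfiable (G : set pformula) : Prop :=
  exists v : nat -> M, forall q, G q -> pvalue v q = 0.

Definition finitely_satisfiable (G : set pformula) : Prop :=
  forall G0, finite_set G0 -> G0 `<=` G -> satisfiable G0.

(* lambda^+-saturation for lambda = |L|: fewer than lambda^+ parameters means
   at most lambda of them. *)
Definition succ_saturated (L : Type) : Prop :=
  forall A : set M, A #<= [set: L] ->
  forall G : set pformula, (forall q, G q -> pformula_over A q) ->
    finitely_satisfiable G -> satisfiable G.

End Saturation.

Section Ultrapower.
Context {R : realType} {I : Type}.

Definition ulim (D : set_system I) (h : I -> R) : R := lim (h @ D).

Lemma ulim01 (D : set_system I) (h : I -> R) : UltraFilter D ->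
  (forall i, 0 <= h i <= 1) -> 0 <= ulim D h <= 1.
Proof.
move=> UD h01.
have PD : ProperFilter (h @ D).
  exact: (@fmap_proper_filter _ _ h D (@ultra_proper _ _ UD)).
have UhD : UltraFilter (h @ D).
  split=> [|G PG hDG]; first exact: PD.
  apply/seteqP; split=> [B GB|]; last exact: hDG.
  have [//|hB] := @in_ultra_setVsetC _ D (h @^-1` B) UD.
  have GCB : G (~` B) by apply: hDG.
  have : G (B `&` ~` B) by exact: filterI.
  by rewrite setICr => /filter_not_empty.
have : compact `[0, 1 : R]%classic by exact: segment_compact.
rewrite compact_ultra => /(_ _ UhD) [|l [/= l01 hl]].
  by apply: nearW => i /=; rewrite in_itv /= h01.
by move: l01; rewrite in_itv /= /ulim (cvg_lim _ hl).
Qed.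

Context {V : vocabulary R} (D : set_system I) (UD : UltraFilter D).
Variable M : structure V.

Definition uclass (f : I -> M) : set (I -> M) :=
  [set g | ulim D (fun i => dist (f i) (g i)) = 0].

Definition ucarrier : Type := {C : set (I -> M) | exists f, C = uclass f}.

Definition upi (f : I -> M) : ucarrier := exist _ (uclass f) (ex_intro _ f erefl).

Definition urepr (C : ucarrier) : I -> M := projT1 (cid (proj2_sig C)).

(* All operations are defined on representatives; uniform continuity makes
   them independent of the choice when M is a metric structure. *)
Definition upint (p : psym V) (a : 'I_(par p) -> ucarrier) : R :=
  ulim D (fun i => pint M p (fun j => urepr (a j) i)).

Definition ufint (f : fsym V) (a : 'I_(far f) -> ucarrier) : ucarrier :=
  upi (fun i => fint M f (fun j => urepr (a j) i)).

Definition udist (x y : ucarrier) : R :=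
  ulim D (fun i => dist (urepr x i) (urepr y i)).

Lemma ucarrier_inhabited : inhabited ucarrier.
Proof. by case: (carrier_inhabited M) => x; exact: inhabits (upi (fun=> x)). Qed.

Lemma upint01 p a : 0 <= @upint p a <= 1.
Proof. by apply: ulim01 => i; exact: pint01. Qed.

Lemma udist01 x y : 0 <= udist x y <= 1.
Proof. by apply: ulim01 => i; exact: dist01. Qed.

Definition ultrapower : structure V :=
  Structure ucarrier_inhabited upint01 ufint udist01.

End Ultrapower.

Definition regular (I : Type) (D : set_system I) : Prop :=
  exists X : set (set I),
    [/\ X `<=` D, X #= [set: I] &
        forall t, finite_set [set A | X A /\ A t]].

Definition Sat (R : realType) (V : vocabulary R) (T : set (formula V))
    (I : Type) (D : set_system I) (UD : UltraFilter D) : Prop :=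
  [/\ infinite_set [set: I], regular D &
      forall M : structure V, model T M -> succ_saturated (ultrapower UD M) I].

(* S \trianglelefteq T *)
Definition keisler_le (R : realType) (V W : vocabulary R)
    (S : set (formula V)) (T : set (formula W)) : Prop :=
  forall (I : Type) (D : set_system I) (UD : UltraFilter D),
    Sat T UD -> Sat S UD.

Section RandomGraph.
Context {R : realType}.

(* One binary predicate symbol.  In a discrete structure d < 1 forces equality, so
   the constant modulus 1 imposes no restriction. *)
Definition graph_vocabulary : vocabulary R :=
  @Vocabulary R unit (fun=> 2%N) (fun=> fun=> 1) (fun _ _ _ => ltr01)
    void (fun=> 0%N) (fun=> fun=> 1) (fun _ _ _ => ltr01).

Definition truth (P : Prop) : R := if `[< P >] then 0 else 1.

Lemma truth01 P : 0 <= truth P <= 1.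
Proof. by rewrite /truth; case: ifP; rewrite lexx ler01. Qed.

Definition graph_structure (G : Type) (G0 : inhabited G) (E : G -> G -> Prop) :
    structure graph_vocabulary :=
  @Structure R graph_vocabulary G G0
    (fun _ a => truth (E (a ord0) (a ord_max))) (fun _ _ => truth01 _)
    (fun f => match f with end)
    (fun x y => truth (x = y)) (fun _ _ => truth01 _).

Definition random_graph (G : Type) (E : G -> G -> Prop) : Prop :=
  [/\ forall x y, E x y -> E y x,
      forall x, ~ E x x &
      forall X Y : set G, finite_set X -> finite_set Y -> X `&` Y = set0 ->
        exists z, (forall x, X x -> E z x) /\ (forall y, Y y -> ~ E z y)].

(* The consequences of the axioms, i.e. the sentences true in every random
   graph regarded as a discrete metric structure. *)
Definition T_rg : set (formula graph_vocabulary) :=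
  [set phi | sentence phi /\
     forall (G : Type) (G0 : inhabited G) (E : G -> G -> Prop),
       random_graph E -> holds (graph_structure G0 E) phi].

End RandomGraph.

(* Main.v *)
Require Import Defs.
From mathcomp Require Import all_boot all_order all_algebra.
From mathcomp Require Import all_classical all_reals all_analysis.
From mathcomp Require Import lra.

(* Let D be a regular ultrafilter on I saturating the unstable theory T.

   (1) A random graph N has a saturated ultrapower as soon as D separates: if
   u_j (j in J, |J| <= |I|) are elements of an ultrapower of the naturals and
   the label l(j) is a function of u_j, there is an internal set containing the
   u_j with true label and none of the others.  By regularity only finitely many
   j matter at each coordinate, where the extension axiom turns the set into a
   vertex.  Types over the ultrapower of N are handled by quantifier elimination.

   (2) Let phi have the order property on (a_h, b_h).  By a homogeneity argument
   with a nonprincipal ultrafilter on the naturals, either phi shatters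
   arbitrarily long finite sequences, and then saturation for phi separates
   directly; or some 0-1 word is avoided by long subsequences of (a_h), so that
   every instance of phi alternates boundedly often along them.

   (3) In the latter case D fills cuts: an instance of phi separating the two
   sides of a pre-cut alternates at most K times, and counting alternations
   turns it into an internal initial segment.

   (4) Filling cuts implies separating.  List the elements with true label
   along a chain of nodes (internal finite sequences) none of which contains an
   element with false label.  A cut in the lexicographic order gives an upper
   bound of a chain, and a cut in the lengths truncates it so that it avoids the
   false elements; so a maximal chain (Zorn) lists all the true ones. *)

Set Implicit Arguments.
Unset Strict Implicit.
Unset Printing Implicit Defensive.

Import Order.TTheory GRing.Theory Num.Theory.
Import numFieldNormedType.Exports.

Local Open Scope classical_set_scope.
Local Open Scope card_scope.
Local Open Scope ring_scope.

(** * Ultrafilters and maximal cliques *)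

Lemma filter_finite (T J : Type) (F : set_system T) (A : set J)
    (f : J -> set T) : Filter F -> finite_set A ->
  (forall j, A j -> F (f j)) -> F (\bigcap_(j in A) f j).
Proof.
move=> FF.
have H (K : choiceType) (B : set K) (g : K -> set T) : finite_set B ->
    (forall j, B j -> F (g j)) -> F (\bigcap_(j in B) g j).
  move=> fB Bg; rewrite -(fset_setK fB); apply: filter_bigI => i.
  by rewrite in_fset_set // inE; exact: Bg.
exact: (H {classic J}).
Qed.

Lemma ultra_dec (T : Type) (F : set_system T) (UF : UltraFilter F) (A : set T) :
  F A \/ F (~` A).
Proof. by have [] := @in_ultra_setVsetC T F A UF; [left|right]. Qed.

Lemma ultraN (T : Type) (F : set_system T) (UF : UltraFilter F) (A : set T) :
  ~ F A <-> F (~` A).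
Proof.
split=> [nA|FnA FA]; first by case: (ultra_dec UF A).
have : F (A `&` ~` A) by exact: filterI.
by rewrite setICr; exact: filter_not_empty.
Qed.

Lemma ultra_const (T : Type) (F : set_system T) (UF : UltraFilter F) (P : Prop) :
  F (fun=> P) <-> P.
Proof.
split=> [FP|p]; last exact: filterS filterT.
by have [t] := filter_ex FP.
Qed.

(** Unions of chains of cliques are cliques, so Zorn applies. It provides both the disjoint families
    of the cardinality argument and the maximal chain of nodes. *)
Lemma maximal_clique (T : Type) (Q : T -> T -> Prop) :
  exists A : set T, (forall x y, A x -> A y -> Q x y) /\
    forall x, Q x x -> (forall y, A y -> Q x y /\ Q y x) -> A x.
Proof.
have [F FQ totF|A [AQ Amax]] :=
    @Zorn_bigcup T [set A | forall x y, A x -> A y -> Q x y].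
  move=> x y [B FB Bx] [C FC Cy].
  have [BC|CB] := totF _ _ FB FC.
    by apply: (FQ _ FC) => //; exact: BC.
  by apply: (FQ _ FB) => //; exact: CB.
exists A; split=> // x Qx QA; apply: contrapT => nAx.
apply: (Amax (x |` A)).
  by split=> [y|/(_ x)]; [right | move=> H; apply/nAx/H; left].
move=> y z [->|Ay] [->|Az] //; last exact: AQ.
  by have [] := QA _ Az.
by have [] := QA _ Ay.
Qed.

(** * Types embedding into the index set *)

Definition small (I J : Type) := exists f : J -> I, injective f.

Lemma small_trans (I J K : Type) : small I J -> small J K -> small I K.
Proof. by move=> [f fi] [g gi]; exists (f \o g); exact: inj_comp. Qed.

Lemma small_nat (I : Type) : infinite_set [set: I] -> small I nat.
Proof.
move=> Iinf; have [i0 _] := infinite_setN0 Iinf.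
move/infiniteP: Iinf => /card_leP[f].
exists (fun n => projT1 (f (SigSub (mem_setT n)))) => m n /val_inj.
by move/(@inj _ _ _ f); rewrite !inE => /(_ Logic.I Logic.I) [].
Qed.

Lemma proj1_sig_inj (T : Type) (P : T -> Prop) : injective (@proj1_sig T P).
Proof. by move=> [x p] [y q] /= e; subst; congr exist; exact: Prop_irrelevance. Qed.

Lemma small_card_le (I T : Type) (A : set T) :
  A #<= [set: I] -> small I {x | A x}.
Proof.
move=> /card_leP[f].
exists (fun x => projT1 (f (SigSub (mem_set (proj2_sig x))))) => x y /val_inj.
move/(@inj _ _ _ f); rewrite !inE => /(_ Logic.I Logic.I) [].
by move=> [/proj1_sig_inj].
Qed.

Lemma card_le_small (I J T : Type) (f : J -> T) : small I J ->
  range f #<= [set: I].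
Proof.
move=> [g gi]; apply: (card_le_trans (card_image_le _ _)).
have e : range g #= [set: J] by apply: inj_card_eq => x y _ _ /gi.
by rewrite -(card_le_eql e); exact: subset_card_le.
Qed.

(* A maximal family of disjoint countably infinite subsets of [I] leaves out a
   finite set only, and each of its members absorbs a factor [nat]. *)
Lemma small_prod_nat (I : Type) : infinite_set [set: I] -> small I (I * nat)%type.
Proof.
move=> Iinf.
have [A [AQ Amax]] := maximal_clique (fun f g : nat -> I =>
  injective f /\ (f = g \/ forall m n, f m <> g n)).
pose F0 : set I := [set x | forall f, A f -> forall n, f n <> x].
have Ffin : finite_set F0.
  apply: contrapT => Finf.
  have [g gi] : exists g : nat -> {x | F0 x}, injective g.
    apply: small_nat => fT; apply: Finf.
    have -> : F0 = (@proj1_sig _ _) @` [set: {x | F0 x}].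
      apply/seteqP; split=> [x Fx|x [[y Fy] _ <-]] //.
      by exists (exist _ x Fx).
    exact: finite_image.
  have F0g n : forall f, A f -> forall m, f m <> proj1_sig (g n).
    exact: (proj2_sig (g n)).
  have gi' : injective (fun n => proj1_sig (g n)).
    by move=> m n /proj1_sig_inj/gi.
  have : A (fun n => proj1_sig (g n)).
    apply: Amax => [|f Af]; first by split=> //; left.
    have [fi _] := AQ f f Af Af.
    by split; split=> //; right => m n; [move/esym|]; exact: F0g.
  by move/F0g => /(_ 0%N 0%N).
have [f0 Af0] : exists f0, A f0.
  apply: contrapT => nA; apply: Iinf; apply: sub_finite_set Ffin => x _ f Af.
  by case: nA; exists f.
have /pcard_injP[r ri] := finite_set_countable Ffin.
(* [x] is located by a member of [A] and its position there; the points of the finite remainder [F0]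
   borrow [f0], marked by the flag [true] and numbered by [r]. *)
have H x : exists t : (nat -> I) * bool * nat, [/\ A t.1.1,
    t.1.2 = false -> x = t.1.1 t.2 & t.1.2 = true -> F0 x /\ t.2 = r x].
  have [Fx|nFx] := pselect (F0 x); first by exists (f0, true, r x).
  have [f [n [Af <-]]] : exists f n, A f /\ f n = x.
    apply: contrapT => N; apply: nFx; rewrite /= => f Af n fn.
    by apply: N; exists f, n.
  by exists (f, false, n).
have [h hP] := choice H.
(* Flag, position and second coordinate are coded into one natural number, so the image stays in the
   range of the member assigned to the first coordinate. *)
exists (fun p => (h p.1).1.1 (choice.pickle ((h p.1).1.2, (h p.1).2, p.2))).
move=> [x m] [y n] /=.
have [Ax xf xt] := hP x; have [Ay yf yt] := hP y.
have [xi [e|ne]] := AQ _ _ Ax Ay; last by move/ne.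
rewrite -e => /xi /(pcan_inj choice.pickleK) [e1 e2 ->].
congr pair.
case E : (h x).1.2 in xf xt e1; last first.
  by rewrite xf // yf ?e ?e2 // -e1.
have [Fx rx] := xt erefl; have [Fy ry] := yt (esym e1).
by apply: ri; rewrite ?inE // -rx -ry.
Qed.

Lemma small_sum (I J K : Type) : infinite_set [set: I] -> small I J ->
  small I K -> small I (J + K)%type.
Proof.
move=> /small_prod_nat sI [f fi] [g gi]; apply: small_trans sI _.
exists (fun s => match s with inl j => (f j, 0%N) | inr k => (g k, 1%N) end).
by move=> [j|k] [j'|k'] [] // => [/fi|/gi] ->.
Qed.

Lemma small_prod_bool (I J : Type) : infinite_set [set: I] -> small I J ->
  small I (J * bool)%type.
Proof.
move=> /small_prod_nat sI [f fi]; apply: small_trans sI _.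
exists (fun p => (f p.1, nat_of_bool p.2)) => -[j b] [k c] /= [/fi ->].
by case: b; case: c.
Qed.

(** [J] injects into [I], and [I] into the regularizing family; injectivity keeps every coordinate
    in finitely many of the chosen sets. *)
Lemma regular_family (I J : Type) (D : set_system I) : regular D -> small I J ->
  exists X : J -> set I, (forall j, D (X j)) /\
    forall i, finite_set [set j | X j i].
Proof.
move=> [F [FD cF Ffin]] [f fi].
have [g gi] : small {A | F A} I.
  move: cF; rewrite card_eq_le => /andP[_ /card_leP[g]].
  exists (fun i => exist _ _ (set_mem (valP (g (SigSub (mem_setT i)))))).
  move=> i j [] /val_inj.
  by move/(@inj _ _ _ g); rewrite !inE => /(_ Logic.I Logic.I) [].
exists (fun j => proj1_sig (g (f j))); split=> [j|i].
  by apply: FD; exact: proj2_sig.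
have fin := Ffin i.
have hi : injective (fun j => proj1_sig (g (f j))).
  by move=> x y /proj1_sig_inj/gi/fi.
have : finite_set ((fun j => proj1_sig (g (f j))) @` [set j | proj1_sig (g (f j)) i]).
  by apply: sub_finite_set fin => _ [j /= ji <-]; split=> //; exact: proj2_sig.
have /card_eqPle[_ le] : (fun j => proj1_sig (g (f j))) @`
  [set j | proj1_sig (g (f j)) i] #= [set j | proj1_sig (g (f j)) i].
  by apply: inj_card_eq => x y _ _ /hi.
exact: card_le_finite.
Qed.

(** * Limits along an ultrafilter and the theorem of Łoś *)

Section UltraLimit.
Context {R : realType} {I : Type} (D : set_system I) (UD : UltraFilter D).
Implicit Types h : I -> R.

Lemma ulim_unique h l :
  (forall e, 0 < e -> D [set i | `|l - h i| < e]) -> ulim D h = l.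
Proof. by move=> H; apply: (@cvg_lim _ _ _ D) => //; apply/cvgrPdist_lt => e; exact: H. Qed.

Lemma ulim_near h : (forall i, 0 <= h i <= 1) ->
  forall e, 0 < e -> D [set i | `|ulim D h - h i| < e].
Proof.
move=> h01.
(* The limit is the supremum of the lower bounds that hold on a set of [D]. *)
pose S := [set c | D [set i | c <= h i]].
have S0 : S 0 by apply: filterS filterT => i _; case/andP: (h01 i).
have Sub : ubound S 1.
  by move=> c /filter_ex [i /= /le_trans]; apply; case/andP: (h01 i).
have supS : has_sup S by split; [exists 0|exists 1].
have H e : 0 < e -> D [set i | `|sup S - h i| < e].
  move=> e0; have [c Sc ce] := sup_adherent e0 supS.
  have /(ultraN UD) He : ~ D [set i | sup S + e <= h i].
    move=> Se; have := sup_upper_bound supS Se; lra.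
  apply: filterS2 Sc He => i /= ch /negP; rewrite -ltNge => he.
  by rewrite ltr_norml; apply/andP; split; lra.
by rewrite (ulim_unique H).
Qed.

Lemma ulim_lt h c : (forall i, 0 <= h i <= 1) -> ulim D h < c ->
  D [set i | h i < c].
Proof.
move=> h01 hc; have := ulim_near h01 (e := c - ulim D h).
rewrite subr_gt0 => /(_ hc); apply: filterS => i /=.
by rewrite ltr_norml => /andP[]; lra.
Qed.

Lemma ulim_gt h c : (forall i, 0 <= h i <= 1) -> c < ulim D h ->
  D [set i | c < h i].
Proof.
move=> h01 hc; have := ulim_near h01 (e := ulim D h - c).
rewrite subr_gt0 => /(_ hc); apply: filterS => i /=.
by rewrite ltr_norml => /andP[]; lra.
Qed.

Lemma ulim_le h c : (forall i, 0 <= h i <= 1) -> D [set i | h i <= c] ->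
  ulim D h <= c.
Proof.
move=> h01 hc; rewrite leNgt; apply/negP => /(ulim_gt h01) H.
by have [i [/= ]] := filter_ex (filterI hc H); lra.
Qed.

Lemma ulim_ge h c : (forall i, 0 <= h i <= 1) -> D [set i | c <= h i] ->
  c <= ulim D h.
Proof.
move=> h01 hc; rewrite leNgt; apply/negP => /(ulim_lt h01) H.
by have [i [/= ]] := filter_ex (filterI hc H); lra.
Qed.

Lemma ulim_leD h g e : (forall i, 0 <= h i <= 1) -> (forall i, 0 <= g i <= 1) ->
  (forall i, h i <= g i + e) -> ulim D h <= ulim D g + e.
Proof.
move=> h01 g01 hg; rewrite leNgt; apply/negP => lt.
pose d := (ulim D h - (ulim D g + e)) / 2.
have d0 : 0 < d by rewrite /d; lra.
have [i [/=]] := filter_ex (filterI (ulim_near h01 d0) (ulim_near g01 d0)).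
by have := hg i; rewrite !ltr_norml /d => ? /andP[? ?] /andP[? ?]; lra.
Qed.

End UltraLimit.

Section Values.
Context {R : realType} {V : vocabulary R} (M : structure V).

Lemma value01 (v : nat -> M) (phi : formula V) : 0 <= value v phi <= 1.
Proof.
case: (carrier_inhabited M) => a0.
elim: phi v => [p ts|t u|n c phis IH|x psi IH|x psi IH] v /=.
- exact: pint01.
- exact: dist01.
- by apply: cfun01 => i; rewrite mxE; exact: IH.
- set S := [set _ | _ in _].
  have S0 : S !=set0 by exists (value (update v x a0) psi); exists a0.
  have Sub : ubound S 1 by move=> _ [a _ <-]; case/andP: (IH (update v x a)).
  rewrite ge_sup // andbT; apply: le_trans (ub_le_sup _ _).
  + by have /andP[h _] := IH (update v x a0); exact: h.
  + by exists 1.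
  + by exists a0.
- set S := [set _ | _ in _].
  have S0 : S !=set0 by exists (value (update v x a0) psi); exists a0.
  have Slb : lbound S 0 by move=> _ [a _ <-]; case/andP: (IH (update v x a)).
  rewrite lb_le_inf //=; apply: le_trans (ge_inf _ _) _.
  + by exists 0.
  + by exists a0.
  + by have /andP[_ h] := IH (update v x a0); exact: h.
Qed.

Lemma value_sup_ge (v : nat -> M) x a psi :
  value (update v x a) psi <= value v (Sup x psi).
Proof.
apply: ub_le_sup; last by exists a.
by exists 1 => _ [b _ <-]; case/andP: (value01 (update v x b) psi).
Qed.

Lemma value_inf_le (v : nat -> M) x a psi :
  value v (Inf x psi) <= value (update v x a) psi.
Proof.
apply: ge_inf; last by exists a.
by exists 0 => _ [b _ <-]; case/andP: (value01 (update v x b) psi).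
Qed.

Lemma value_sup_adherent (v : nat -> M) x psi e : 0 < e ->
  exists a, value v (Sup x psi) - e < value (update v x a) psi.
Proof.
case: (carrier_inhabited M) => a0 e0.
have [|_ [a _ <-] H] := @sup_adherent R
    [set value (update v x a) psi | a in [set: M]] e e0.
  split; first by exists (value (update v x a0) psi); exists a0.
  by exists 1 => _ [b _ <-]; case/andP: (value01 (update v x b) psi).
by exists a.
Qed.

Lemma value_inf_adherent (v : nat -> M) x psi e : 0 < e ->
  exists a, value (update v x a) psi < value v (Inf x psi) + e.
Proof.
case: (carrier_inhabited M) => a0 e0.
have [|_ [a _ <-] H] := @inf_adherent R
    [set value (update v x a) psi | a in [set: M]] e e0.
  split; first by exists (value (update v x a0) psi); exists a0.
  by exists 0 => _ [b _ <-]; case/andP: (value01 (update v x b) psi).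
by exists a.
Qed.

Lemma value_sup_le (v : nat -> M) x psi c :
  (forall a, value (update v x a) psi <= c) -> value v (Sup x psi) <= c.
Proof.
move=> H; case: (carrier_inhabited M) => a0.
apply: ge_sup; first by exists (value (update v x a0) psi); exists a0.
by move=> _ [a _ <-]; exact: H.
Qed.

Lemma value_inf_ge (v : nat -> M) x psi c :
  (forall a, c <= value (update v x a) psi) -> c <= value v (Inf x psi).
Proof.
move=> H; case: (carrier_inhabited M) => a0.
apply: lb_le_inf; first by exists (value (update v x a0) psi); exists a0.
by move=> _ [a _ <-]; exact: H.
Qed.

End Values.

Section Los.
Context {R : realType} {V : vocabulary R} {I : Type} (D : set_system I).
Context (UD : UltraFilter D) (M : structure V) (mM : metric_structure M).

Lemma dist_xx (x : M) : dist x x = 0.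
Proof. by case: mM => -[H _ _] _ _; apply/H. Qed.

Lemma uclass_urepr (C : ucarrier D M) : proj1_sig C = uclass D (urepr C).
Proof. by rewrite /urepr; case: cid. Qed.

(** [urepr] chooses its own representative, so [f] is recovered only up to small distances on sets
    of [D]. *)
Lemma urepr_upi (f : I -> M) e : 0 < e ->
  D [set i | dist (f i) (urepr (upi D f) i) < e].
Proof.
move=> e0; have Hf : uclass D f (urepr (upi D f)).
  rewrite -[uclass D f]/(proj1_sig (upi D f)) uclass_urepr /uclass /=.
  apply: ulim_unique => d d0; apply: filterS filterT => i _ /=.
  by rewrite dist_xx subrr normr0.
by apply: (ulim_lt UD) => [i|]; [exact: dist01 | rewrite Hf].
Qed.

Lemma upi_urepr (C : ucarrier D M) : upi D (urepr C) = C.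
Proof. by apply: proj1_sig_inj; rewrite /= -uclass_urepr. Qed.

Lemma term_val_ultrapower (r : nat -> I -> M) (t : term V) e : 0 < e ->
  D [set i | dist (urepr (term_val (M := ultrapower UD M)
                            (fun x => upi D (r x)) t) i)
                  (term_val (fun x => r x i) t) < e].
Proof.
have [[_ dC dT] _ [_ uf]] := mM.
elim: t e => [x|f ts IH] e e0 /=.
  by apply: filterS (urepr_upi (r x) e0) => i; rewrite /= dC.
have e2 : 0 < e / 2 by lra.
rewrite /ufint.
set g := fun i => fint M f _.
have : D [set i | forall j, dist (urepr (term_val (M := ultrapower UD M)
    (fun x => upi D (r x)) (ts j)) i) (term_val (fun x => r x i) (ts j)) < fmod f (e / 2)].
  by apply: filter_forall => j; exact: IH (fmod_gt0 f e2).
apply: filterS2 (urepr_upi g e2) => i /= Hg Hj.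
have := uf f _ _ _ e2 Hj.
have := dT (urepr (upi D g) i) (g i) (fint M f (fun j => term_val (fun x => r x i) (ts j))).
by rewrite -/(g i) (dC _ (g i)); lra.
Qed.

(* The representatives [r] are arbitrary, so the quantifier steps need no
   uniform continuity of formulas. *)
Lemma value_ultrapower (r : nat -> I -> M) (phi : formula V) :
  value (M := ultrapower UD M) (fun x => upi D (r x)) phi =
  ulim D (fun i => value (fun x => r x i) phi).
Proof.
move: r; have [[_ dC dT] _ [up _]] := mM.
pose r' (r : nat -> I -> M) (x : nat) f (y : nat) := if y == x then f else r y.
have E r x f : update (M := ultrapower UD M) (fun y => upi D (r y)) x (upi D f) =
    (fun y => upi D (r' r x f y)).
  by apply/funext => y; rewrite /update /r'; case: eqP.
have E' r x f i : (fun y => r' r x f y i) = update (fun y => r y i) x (f i).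
  by apply/funext => y; rewrite /update /r'; case: eqP.
elim: phi => [p ts|t u|n c phis IH|x psi IH|x psi IH] r.
- apply/esym/ulim_unique => e e0 /=.
  rewrite /upint; set h := fun i => pint M p _.
  have h01 i : 0 <= h i <= 1 by exact: pint01.
  have e2 : 0 < e / 2 by lra.
  have : D [set i | forall j, dist (urepr (term_val (M := ultrapower UD M)
      (fun x => upi D (r x)) (ts j)) i) (term_val (fun x => r x i) (ts j)) < pmod p (e / 2)].
    by apply: filter_forall => j; exact: term_val_ultrapower (pmod_gt0 p e2).
  apply: filterS2 (ulim_near UD h01 e2) => i /= H1 Hj.
  have := up p _ _ _ e2 Hj; rewrite -/(h i) => H2.
  rewrite -(subrK (h i) (ulim D h)) -addrA.
  by apply: le_lt_trans (ler_normD _ _) _; lra.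
- apply/esym/ulim_unique => e e0 /=.
  rewrite /udist; set h := fun i => dist _ _.
  have h01 i : 0 <= h i <= 1 by exact: dist01.
  have e3 : 0 < e / 3 by lra.
  apply: filterS3 (term_val_ultrapower r t e3) (term_val_ultrapower r u e3)
    (ulim_near UD h01 e3) => i /=.
  rewrite /h; set a := urepr _ i; set b := urepr _ i.
  set a' := term_val _ t; set b' := term_val _ u => Ha Hb H1.
  have := dT a a' b; have := dT a' b' b; have := dT a' a b'; have := dT a b b' => d1 d2 d3 d4.
  have := dC b' b; have := dC a' a => d5 d6.
  move: H1; rewrite !ltr_norml => /andP[? ?].
  by apply/andP; split; lra.
- apply/esym/ulim_unique => e e0 /=.
  set L := \row_i _.
  have LE k : L ord0 k = ulim D (fun i => value (fun x => r x i) (phis k)).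
    by rewrite mxE; exact: IH.
  have Lc : unit_cube L by move=> k; rewrite mxE; exact: value01.
  have /subspace_continuousP/(_ _ Lc)/cvgrPdist_lt/(_ _ e0) := @cfun_continuous R n c.
  move=> H; have /nbhs_ballP[d /= d0 Hd] : nbhs L [set y | unit_cube y -> `|c L - c y| < e] := H.
  have : D [set i | forall k, `|ulim D (fun i => value (fun x => r x i) (phis k)) -
      value (fun x => r x i) (phis k)| < d].
    by apply: filter_forall => k; apply: ulim_near d0 => i; exact: value01.
  apply: filterS => i /= Hi; apply: Hd.
    by split=> // i0 k; rewrite (ord1 i0) LE mxE; exact: Hi.
  by move=> k; rewrite mxE; exact: value01.
- apply/eqP; rewrite eq_le; apply/andP; split.
    apply: value_sup_le => C; rewrite -(upi_urepr C) E (IH (r' r x (urepr C))) -[leRHS]addr0.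
    apply: (ulim_leD UD) => i; [exact: value01 | exact: value01 |].
    by rewrite addr0 E'; exact: value_sup_ge.
  apply/ler_addgt0Pr => e e0.
  (* [f] chooses at each coordinate a witness within [e] of the supremum; its class is then tested
     in the ultrapower. *)
  have [f Hf] := choice (fun i => value_sup_adherent (fun y => r y i) x psi e0).
  have := value_sup_ge (M := ultrapower UD M) (fun y => upi D (r y)) x (upi D f) psi.
  rewrite E (IH (r' r x f)) -(lerD2r e); apply: le_trans.
  apply: (ulim_leD UD) => i; [exact: value01 | exact: value01 |].
  by rewrite E' -lerBlDr; exact: ltW.
- apply/eqP; rewrite eq_le; apply/andP; split; last first.
    apply: value_inf_ge => C; rewrite -(upi_urepr C) E (IH (r' r x (urepr C))) -[leRHS]addr0.
    apply: (ulim_leD UD) => i; [exact: value01 | exact: value01 |].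
    by rewrite addr0 E'; exact: value_inf_le.
  apply/ler_addgt0Pr => e e0.
  have [f Hf] := choice (fun i => value_inf_adherent (fun y => r y i) x psi e0).
  apply: (le_trans (value_inf_le (M := ultrapower UD M) (fun y => upi D (r y)) x (upi D f) psi)).
  rewrite E (IH (r' r x f)).
  apply: (ulim_leD UD) => i; [exact: value01 | exact: value01 |].
  by rewrite E'; exact: ltW.
Qed.

End Los.

(** * Realizing threshold conditions in a saturated ultrapower *)

(* [(`|a| + a) / 2] is the positive part of [a]: the connective vanishes iff
   its argument is [<= t] (for [b = true]), resp. [>= t]. *)
Section Threshold.
Context {R : realType} (b : bool) (t : R) (t01 : 0 <= t <= 1).

Let excess (x : R) : R := if b then x - t else t - x.

Definition threshold_fun (x : 'rV[R]_1) : R :=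
  (`|excess (x ord0 ord0)| + excess (x ord0 ord0)) / 2.

Lemma threshold_continuous : {within @unit_cube R 1, continuous threshold_fun}.
Proof.
apply: continuous_subspaceT => x.
pose g (z : R) : R := (`|excess z| + excess z) / 2.
have gc : continuous g.
  move=> z; have E : excess y @[y --> z] --> excess z.
    rewrite /excess; case: b.
      by apply: cvgB; [exact: cvg_id | exact: cvg_cst].
    by apply: cvgB; [exact: cvg_cst | exact: cvg_id].
  by apply: cvgM; [apply: cvgD => //; exact: cvg_norm | exact: cvg_cst].
by apply: (@continuous_comp _ _ _ (fun y : 'rV[R]_1 => y ord0 ord0) g);
  [exact: coord_continuous | exact: gc].
Qed.

Lemma threshold01 x : unit_cube x -> 0 <= threshold_fun x <= 1.
Proof.
case/andP: t01 => ? ? /(_ ord0) /andP[]; rewrite /threshold_fun /excess.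
set z := x _ _ => ? ?.
by case: b; [have [] := ger0P (z - t)|have [] := ger0P (t - z)] => ?;
  apply/andP; split; lra.
Qed.

Definition threshold : connective R 1 :=
  Connective threshold_continuous threshold01.

Lemma threshold_eq0 (x : 'rV[R]_1) : threshold x = 0 <->
  if b then x ord0 ord0 <= t else t <= x ord0 ord0.
Proof.
rewrite /= /threshold_fun /excess; set z := x _ _.
by case: b; [have [] := ger0P (z - t)|have [] := ger0P (t - z)] => ?;
  split=> ?; lra.
Qed.

End Threshold.

Section Realize.
Context {R : realType} {V : vocabulary R} {I : Type} (D : set_system I).
Context (UD : UltraFilter D) (M : structure V) (mM : metric_structure M).
Variables (phi : formula V) (xs : seq nat).

Definition split_value (a b : nat -> M) : R :=
  value (fun x => if x \in xs then a x else b x) phi.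

(** The x-block becomes parameters and the y-block is the unknown tuple. The strict gaps from [s] to
    [s'] and from [r'] to [r] turn inequalities between limits into inequalities on a set of [D]. *)
Lemma realize (J : Type) (alpha : J -> I -> nat -> M) (l : J -> bool)
    (s r s' r' : R) : infinite_set [set: I] -> small I J ->
  succ_saturated (ultrapower UD M) I ->
  0 <= s <= 1 -> 0 <= r <= 1 -> s < s' -> r' < r ->
  (forall J0, finite_set J0 -> exists y : I -> nat -> M, forall j, J0 j ->
     D [set i | if l j then split_value (alpha j i) (y i) <= s
                else r <= split_value (alpha j i) (y i)]) ->
  exists y : I -> nat -> M, forall j,
     D [set i | if l j then split_value (alpha j i) (y i) <= s'
                else r' <= split_value (alpha j i) (y i)].
Proof.
move=> Iinf sJ sat s01 r01 ss' r'r fin.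
have [/asboolP[j0]|nJ] := boolP `[< inhabited J >]; last first.
  case: (carrier_inhabited M) => a0; exists (fun _ _ => a0) => j.
  by exfalso; move/asboolP: nJ; apply.
pose t j := if l j then s else r.
have t01 j : 0 <= t j <= 1 by rewrite /t; case: ifP.
pose rho j (x : nat) : option (ultrapower UD M) :=
  if x \in xs then Some (upi D (fun i => alpha j i x)) else None.
pose q j : pformula (ultrapower UD M) :=
  (Conn (threshold (l j) (t01 j)) (fun _ => phi), rho j).
have q0 (y : I -> nat -> M) j :
    pvalue (M := ultrapower UD M) (fun x => upi D (fun i => y i x)) (q j) = 0 <->
    if l j then ulim D (fun i => split_value (alpha j i) (y i)) <= s
    else r <= ulim D (fun i => split_value (alpha j i) (y i)).
  pose L : 'rV[R]_1 := \row_(_ < 1) value (M := ultrapower UD M)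
    (fun x => odflt (upi D (fun i => y i x)) (rho j x)) phi.
  apply: (iff_trans (@threshold_eq0 _ _ _ (t01 j) L)); rewrite mxE.
  suff -> : value (M := ultrapower UD M)
      (fun x => odflt (upi D (fun i => y i x)) (rho j x)) phi =
      ulim D (fun i => split_value (alpha j i) (y i)).
    by rewrite /t; case: (l j).
  pose g x i := if x \in xs then alpha j i x else y i x.
  have -> : (fun x => odflt (upi D (fun i => y i x)) (rho j x)) = (fun x => upi D (g x)).
    by apply/funext => x; rewrite /rho /g; case: (x \in xs).
  exact: (value_ultrapower UD mM g).
have v01 (a b : I -> nat -> M) i : 0 <= split_value (a i) (b i) <= 1 by exact: value01.
(* Each [j] may contribute a parameter for every variable. *)
have sN : small I (J * nat)%type.
  have [f fi] := sJ; apply: small_trans (small_prod_nat Iinf) _.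
  by exists (fun p => (f p.1, p.2)) => -[j n] [k m] /= [/fi -> ->].
have := sat _ (card_le_small (fun p : J * nat => upi D (fun i => alpha p.1 i p.2)) sN)
  (range q).
case=> [_ [j _ <-] x a|G0 G0fin G0q|v vq].
- rewrite /= /rho; case: ifP => // _ [<-].
  by exists (j, x).
- have /choice[h hq] : forall g, exists j, G0 g -> q j = g.
    move=> g; have [/G0q[j _ <-]|] := pselect (G0 g); first by exists j.
    by exists j0.
  have [y yP] := fin _ (finite_image h G0fin).
  exists (fun x => upi D (fun i => y i x)) => g Gg.
  rewrite -(hq g Gg); apply/q0.
  have := yP (h g) (ex_intro2 _ _ g Gg erefl); case: (l (h g)) => H.
    exact: (ulim_le UD (v01 _ _) H).
  exact: (ulim_ge UD (v01 _ _) H).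
- exists (fun i x => urepr (v x) i) => j.
  have := vq (q j) (ex_intro2 _ _ j Logic.I erefl).
  have -> : v = (fun x => upi D (fun i => urepr (v x) i)).
    by apply/funext => x; rewrite upi_urepr.
  move/q0; case: (l j) => H.
    have /(ulim_lt UD (v01 _ _)) := le_lt_trans H ss'.
    apply: filterS => i /= /ltW; rewrite (_ : (fun x => _) = (fun x => urepr (v x) i)) //.
    by apply/funext => x; rewrite upi_urepr.
  have /(ulim_gt UD (v01 _ _)) := lt_le_trans r'r H.
  apply: filterS => i /= /ltW; rewrite (_ : (fun x => _) = (fun x => urepr (v x) i)) //.
  by apply/funext => x; rewrite upi_urepr.
Qed.

End Realize.

(** * Independence versus bounded alternation *)

Section Often.
Variables (U : set_system nat) (UU : UltraFilter U).
Implicit Types (P : seq nat -> Prop) (s t : seq nat).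

(** The quantifier of the [k]-th tensor power of [U]: for most h_1, then for most h_2, and so on.
    New entries are consed, so the latest is the head. *)
Fixpoint often k P s : Prop :=
  if k is k'.+1 then U [set h | often k' P (h :: s)] else P s.

Lemma oftenN k P s : ~ often k P s -> often k (fun s => ~ P s) s.
Proof.
elim: k s => [//|k IH] s /= /(ultraN UU).
by apply: filterS => h; exact: IH.
Qed.

Lemma often_forall (W : finType) k (P : W -> seq nat -> Prop) s :
  (forall w, often k (P w) s) -> often k (fun s => forall w, P w s) s.
Proof.
elim: k s => [//|k IH] s /= H.
by apply: filterS (filter_forall _ H) => h; exact: IH.
Qed.

(** The ultrafilter proof of Ramsey's theorem. The invariant is that each subsequence, of length at
    most [m], of the list built so far still extends often to one satisfying [P]. *)
Lemma often_homogeneous (Uoo : forall N, U [set h | (N < h)%N]) m P n :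
  often m P [::] -> exists t, [/\ size t = n, sorted gtn t &
    forall s, subseq s t -> size s = m -> P s].
Proof.
move=> PU.
suff [t [tn ts tP]] : exists t, [/\ size t = n, sorted gtn t &
    forall s, subseq s t -> (size s <= m)%N -> often (m - size s) P s].
  exists t; split=> // s st sm; have := tP s st.
  by rewrite sm leqnn subnn => /(_ isT).
elim: n => [|n [t [tn ts tP]]].
  by exists [::]; split=> // s; rewrite subseq0 => /eqP-> _; rewrite subn0.
(* A list has finitely many subsequences, one per mask at most, so most [h] preserve the invariant
   for all of them; [Uoo] lets [h] exceed the head. *)
have H1 : U [set h | forall b : (size t).-tuple bool,
    (size (mask b t) < m)%N -> often (m - (size (mask b t)).+1) P (h :: mask b t)].
  apply: filter_forall => b.
  have [sm|] := ltnP (size (mask b t)) m; last by move=> _; exact: filterS filterT.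
  have := tP _ (mask_subseq b t) (ltnW sm); rewrite -(subnSK sm).
  by apply: filterS => h.
have [h [/= hP ht]] := filter_ex (filterI H1 (Uoo (head 0%N t))).
exists (h :: t); split=> /=; first by rewrite tn.
  by case: (t) ts ht => //= x t' -> ->.
move=> s; case: s => [|x s]; first by rewrite /= subn0.
rewrite /=; case: eqP => [-> /subseqP[b bs ->] sm|_ st sm].
  by have := hP (Tuple (introT eqP bs)) sm.
exact: tP.
Qed.

End Often.

(* The alternation [Z, O, Z, O, ...] of length [k] occurs at a weakly increasing
   sequence of positions up to [n]. *)
Fixpoint alternates (Z O : nat -> Prop) (k n : nat) : Prop :=
  if k is k'.+1 then
    exists n', [/\ (n' <= n)%N, (if odd k' then O n' else Z n') & alternates Z O k' n']
  else True.

Lemma alternates_le Z O k m n : (m <= n)%N -> alternates Z O k m -> alternates Z O k n.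
Proof. by case: k => // k mn [p [pm Zp kp]]; exists p; split=> //; exact: leq_trans mn. Qed.

Fixpoint matches (Z O : nat -> Prop) (w : seq bool) (s : seq nat) : Prop :=
  match w, s with
  | b :: w, h :: s => (if b then Z h else O h) /\ matches Z O w s
  | [::], [::] => True
  | _, _ => False
  end.

Lemma matches_nth Z O w s : matches Z O w s ->
  forall h, (h < size s)%N -> if nth true w h then Z (nth 0%N s h) else O (nth 0%N s h).
Proof.
elim: w s => [|b w IH] [|x s] //= [bx ws] [_ //|h] /=.
by rewrite ltnS; exact: IH.
Qed.

Lemma matches_size Z O w s : matches Z O w s -> size s = size w.
Proof. by elim: w s => [|b w IH] [|x s] //= [_ /IH ->]. Qed.

Lemma matches_map (Z O Z' O' : nat -> Prop) (f : nat -> nat) w s :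
  (forall h, Z h -> Z' (f h)) -> (forall h, O h -> O' (f h)) ->
  matches Z O w s -> matches Z' O' w (map f s).
Proof.
move=> HZ HO; elim: w s => [|b w IH] [|x s] //= [bx /IH ?].
by split=> //; case: b bx; [exact: HZ|exact: HO].
Qed.

Lemma subseq_rev_iota h n s : (h < n)%N -> subseq s (rev (iota 0 h)) ->
  subseq (h :: s) (rev (iota 0 n)).
Proof.
move=> hn sh; rewrite -(subnKC hn) iotaD rev_cat -(addn1 h) iotaD rev_cat /= add0n.
by apply: subseq_trans (suffix_subseq _ _) => /=; rewrite eqxx.
Qed.

(* Each pair of consecutive alternations provides one letter of [w], whichever
   it is. *)
Lemma alternates_matches Z O w n : (forall h, Z h -> ~ O h) ->
  alternates Z O (size w).*2 n ->
  exists m s, [/\ (m = 0 \/ O m.-1 /\ m.-1 <= n)%N,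
    subseq s (rev (iota 0 m)) & matches Z O w s].
Proof.
move=> ZO; elim: w n => [|b w IH] n; first by exists 0%N, [::]; split=> //; left.
rewrite [size _]/= doubleS /= odd_double /=.
move=> [n1 [n1n On1 [n2 [n21 Zn2 /IH[m [s [mO sm ws]]]]]]].
(* For positive [m], [m.-1] carries [O] while [n2] carries [Z], so [m.-1 <= n2] is strict. *)
have mn2 : (m <= n2)%N.
  case: mO => [-> //|[Om]]; case: m Om {sm} => //= m Om mn2.
  rewrite ltn_neqAle mn2 andbT; apply/eqP => e.
  by apply: ZO Zn2 _; rewrite -e.
have sub h : (m <= h)%N -> subseq s (rev (iota 0 h)).
  move=> mh; apply: (subseq_trans sm); rewrite -(subnKC mh) iotaD rev_cat.
  exact: suffix_subseq.
exists n1.+1, ((if b then n2 else n1) :: s); split; first by right.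
  by apply: subseq_rev_iota; [case: (b) | apply: sub; case: (b) => //; exact: leq_trans n21].
by split=> //; case: b.
Qed.

(** If each word is matched often, a list homogeneous for all words of length [m] at once is
    shattered. Otherwise some word is missed throughout a homogeneous list, where alternations twice
    as many as its letters would spell it. *)
Lemma independence_or_bounded_alternation (Y : Type) (Lo Hi : Y -> nat -> Prop) :
  (forall y h, Lo y h -> ~ Hi y h) ->
  (forall m, exists f : nat -> nat, forall w : nat -> bool, exists y,
     forall h, (h < m)%N -> if w h then Lo y (f h) else Hi y (f h)) \/
  (exists K, forall n, exists f : nat -> nat,
     (forall h k, (h < k)%N -> (k <= n)%N -> (f h < f k)%N) /\
     forall y p, ~ alternates (fun h => (h <= n)%N /\ Lo y (f h))
                              (fun h => (h <= n)%N /\ Hi y (f h)) K p).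
Proof.
move=> LH.
have [U [UU Uoo]] := ultraFilterLemma (eventually_filter).
have {}Uoo N : U [set h | (N < h)%N] by apply: Uoo; exact: nbhs_infty_gt.
pose P w s := exists y, matches (Lo y) (Hi y) w s.
have [ip|nip] := pselect (forall w, often U (size w) (P w) [::]); [left|right].
  move=> m.
  have /(often_homogeneous UU Uoo m)[t [tm _ /(_ t (subseq_refl t) tm) tP]] :
      often U m (fun s => forall w : m.-tuple bool, P w s) [::].
    by apply: often_forall => w; have := ip w; rewrite size_tuple.
  exists (nth 0%N t) => w; have [y Hy] := tP [tuple w i | i < m].
  exists y => h hm; have := matches_nth Hy (h := h); rewrite tm => /(_ hm).
  by rewrite (nth_map (Ordinal hm)) ?size_enum_ord // nth_enum_ord.
have [w nw] : exists w, ~ often U (size w) (P w) [::] by apply/existsNP.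
have {}nw := oftenN UU nw.
exists (size w).*2 => n.
have [t [tn ts tP]] := often_homogeneous UU Uoo n.+1 nw.
(* The homogeneous list is decreasing, so it is reversed to index an increasing sequence. *)
exists (nth 0%N (rev t)); split=> [h k hk kn|y p].
  have := sorted_ltn_nth ltn_trans 0%N (s := rev t).
  rewrite rev_sorted => /(_ ts) H; apply: H => //; rewrite inE size_rev tn ltnS //.
  exact: leq_trans (ltnW hk) kn.
move=> /alternates_matches[|m [s [mO sm ws]]].
  by move=> h [_ L] [_ /(LH _ _ L)].
apply: (tP (map (nth 0%N (rev t)) s)); last first.
- exists y; apply: matches_map ws; by move=> h [].
- by rewrite size_map; exact: matches_size ws.
have mn : (m <= n.+1)%N by case: mO => [-> //|[[]]]; case: (m).
have tE : t = map (nth 0%N (rev t)) (rev (iota 0 n.+1)).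
  by rewrite map_rev -tn -(size_rev t) map_nth_iota0 // take_size revK.
rewrite {2}tE map_subseq //; apply: (subseq_trans sm).
by rewrite -(subnKC mn) iotaD rev_cat suffix_subseq.
Qed.

Lemma alternatesS Z O k n : alternates Z O k.+1 n -> alternates Z O k n.
Proof. by move=> [p [pn _]]; exact: alternates_le. Qed.

Lemma alternates_anti Z O k m n : (k <= m)%N -> alternates Z O m n -> alternates Z O k n.
Proof.
move=> /subnKC <-; elim: (m - k)%N => [|d IH]; first by rewrite addn0.
by rewrite addnS => /alternatesS.
Qed.

(** * Cuts and separation from realized threshold conditions *)

Definition realizes (R : realType) (I : Type) (D : set_system I) (X Y : Type)
    (val : X -> Y -> R) (s r s' r' : R) : Prop :=
  forall (J : Type) (alpha : J -> I -> X) (l : J -> bool), small I J ->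
  (forall J0, finite_set J0 -> exists y : I -> Y, forall j, J0 j ->
     D [set i | if l j then val (alpha j i) (y i) <= s
                else r <= val (alpha j i) (y i)]) ->
  exists y : I -> Y, forall j,
     D [set i | if l j then val (alpha j i) (y i) <= s'
                else r' <= val (alpha j i) (y i)].

(* Every pre-cut of size at most [|I|] of an ultraproduct of linear orders is
   filled by an internal one. *)
Definition fills_cuts (I : Type) (D : set_system I) : Prop :=
  forall (d : Order.disp_t) (T : orderType d) (J : Type) (x : J -> I -> T)
    (l : J -> bool), small I J ->
  (forall j k, l j -> ~~ l k -> D [set i | (x j i < x k i)%O]) ->
  exists W : I -> set T,
    (forall i z z', (z <= z')%O -> W i z' -> W i z) /\
    forall j, D [set i | if l j then W i (x j i) else ~ W i (x j i)].

Definition separates (I : Type) (D : set_system I) : Prop :=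
  forall (J : Type) (u : J -> I -> nat) (l : J -> bool), small I J ->
  (forall j k, l j -> ~~ l k -> D [set i | u j i != u k i]) ->
  exists S : I -> set nat,
    forall j, D [set i | if l j then S i (u j i) else ~ S i (u j i)].

Section Cuts.
Context {R : realType} {I : Type} (D : set_system I) (UD : UltraFilter D).
Context (Iinf : infinite_set [set: I]) (regD : regular D).
Context (X Y : Type) (val : X -> Y -> R) (s r s1 r1 : R).
Hypothesis real : realizes D val s r s1 r1.

(** Regularity leaves finitely many [x j i] at each coordinate, and their ranks serve as positions
    along the order-property sequence. A realized [y] is low at left ranks and high at right ones;
    as it alternates boundedly, counting alternations defines the cut. *)
Lemma bounded_alternation_fills_cuts K :
  (forall n, exists (a : nat -> X) (b : nat -> Y),
    [/\ forall h k, (h < k)%N -> (k <= n)%N -> val (a h) (b k) <= s,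
        forall h k, (k <= h)%N -> (h <= n)%N -> r <= val (a h) (b k) &
        forall y p, ~ alternates (fun h => (h <= n)%N /\ val (a h) y <= s1)
                                 (fun h => (h <= n)%N /\ r1 <= val (a h) y) K p]) ->
  fills_cuts D.
Proof.
move=> /choice[A /choice[B AB]] d T J x l sJ xl.
have [X0 [DX X0fin]] := regular_family regD sJ.
have [sq sqP] : exists sq : I -> seq T, forall i j, X0 j i -> x j i \in sq i.
  suff H i : exists t : seq T, forall j, X0 j i -> x j i \in t.
    by have [f fP] := choice H; exists f.
  have /finite_seqP[t tE] := finite_image (x^~ i) (X0fin i).
  exists t => j ji; have : [set` t] (x j i) by rewrite -tE; exists j.
  by [].
pose n i := size (sq i).
pose g i z := count (fun f => (f < z)%O) (sq i).
have gn i z : (g i z <= n i)%N by exact: count_size.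
have gle i z z' : (z <= z')%O -> (g i z <= g i z')%N.
  by move=> zz'; apply: sub_count => f /= fz; exact: lt_le_trans zz'.
have glt i z z' : z \in sq i -> (z < z')%O -> (g i z < g i z')%N.
  move=> zi zz'; have /permP E := perm_to_rem zi.
  rewrite /g !E /= ltxx zz' ltnS; apply: sub_count => f /= fz; exact: lt_trans zz'.
have [|y yP] := real (alpha := fun j i => A (n i) (g i (x j i))) (l := l) sJ.
  move=> J0 J0fin; have /(@finite_seqP {classic J})[js jsE] := J0fin.
  (* [B (n i) (t i)] cuts just above the largest left rank in [J0]: values are low before [t i] and
     high from there on. *)
  pose t i := \max_(j <- js | l j) (g i (x j i)).+1.
  exists (fun i => B (n i) (t i)) => j jJ0.
  have jjs : j \in js by move: jJ0; rewrite jsE.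
  have HX : D (\bigcap_(k in J0) X0 k).
    by apply: filter_finite => // k _; exact: DX.
  have [lj|nlj] := boolP (l j).
    apply: filterS HX => i /= Hi; have [Alo _ _] := AB (n i); apply: Alo.
      exact: (@leq_bigmax_seq {classic J} js l (fun j => (g i (x j i)).+1) j).
    apply/bigmax_leqP_seq => k kjs lk.
    have xk : x k i \in sq i by apply/sqP/Hi; rewrite jsE.
    have /permP E := perm_to_rem xk.
    rewrite /g E /= ltxx add0n; apply: leq_ltn_trans (count_size _ _) _.
    by rewrite size_rem // ltn_predL; case: (sq i) xk.
  have HX' : D (\bigcap_(k in [set k | J0 k /\ l k]) [set i | (x k i < x j i)%O]).
    apply: filter_finite => [|k [_ lk]]; last exact: xl.
    by apply: sub_finite_set J0fin => k [].
  apply: filterS2 HX HX' => i /= Hi Hi'; have [_ Ahi _] := AB (n i); apply: Ahi => //.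
  apply/bigmax_leqP_seq => k kjs lk; have Jk : J0 k by rewrite jsE.
  by apply: glt; [apply: sqP; exact: Hi | exact: Hi'].
pose Z i h := (h <= n i)%N /\ val (A (n i) h) (y i) <= s1.
pose O i h := (h <= n i)%N /\ r1 <= val (A (n i) h) (y i).
have ZO j : D [set i | if l j then Z i (g i (x j i)) else O i (g i (x j i))].
  by apply: filterS (yP j) => i /=; case: (l j).
have [nolo|[j0 lj0]] : (forall j, ~ l j) \/ exists j, l j.
  have [H|H] := pselect (exists j, l j); first by right.
  by left=> j lj; apply: H; exists j.
  exists (fun _ => set0); split=> // j; have /negP/negbTE -> := nolo j.
  by apply: filterS filterT => i _ [].
pose P k := `[< exists2 j, l j & D [set i | alternates (Z i) (O i) k (g i (x j i))] >].
have P0 : exists k, P k.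
  by exists 0%N; apply/asboolP; exists j0 => //; exact: filterS filterT.
have PK k : P k -> (k <= K)%N.
  move=> /asboolP[j _ /filter_ex[i /= H]]; rewrite leqNgt; apply/negP => Kk.
  have [_ _ noalt] := AB (n i).
  exact: noalt (alternates_anti (ltnW Kk) H).
case: (ex_maxnP P0 PK) => k /asboolP[j1 lj1 Dk] kmax.
(* An even maximum could be increased by the low value at [j1] itself. *)
have oddk : odd k.
  apply: contraT => evk; have : P k.+1.
    apply/asboolP; exists j1 => //; have := ZO j1; rewrite lj1.
    apply: filterS2 Dk => i /= ka Zi.
    by exists (g i (x j1 i)); rewrite (negbTE evk).
  by move/kmax; rewrite ltnn.
(* On the left, one more alternation contradicts maximality; on the right, the [k] alternations
   below [x j1] are followed by the high value at [x j], as [k] is odd. *)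
exists (fun i => [set z | ~ alternates (Z i) (O i) k.+1 (g i z)]); split.
  by move=> i z z' zz' nW /(alternates_le (gle i z z' zz')).
move=> j; case: (boolP (l j)) => lj.
  apply/(ultraN UD) => H; have /kmax : P k.+1 by apply/asboolP; exists j.
  by rewrite ltnn.
have := ZO j; rewrite (negbTE lj).
apply: filterS3 Dk (xl _ _ lj1 lj) => i /= ka xij Oi; apply; exists (g i (x j i)).
rewrite oddk; split=> //; apply: alternates_le ka; apply: gle; exact: ltW.
Qed.

(** At each coordinate the first [m i] terms cover the finitely many active [u j i], and shattering
    them realizes any finite set of labels. A common solution [y] yields the set of points of low
    value; [s1 < r1] keeps the high ones out. *)
Lemma independence_separates : s1 < r1 ->
  (forall m, exists a : nat -> X, forall w : nat -> bool, exists y, forall h,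
     (h < m)%N -> if w h then val (a h) y <= s else r <= val (a h) y) ->
  separates D.
Proof.
move=> sr1 /choice[A AP] J u l sJ ul.
have [X0 [DX X0fin]] := regular_family regD sJ.
have [m mP] : exists m : I -> nat, forall i j, X0 j i -> (u j i < m i)%N.
  suff H i : exists m, forall j, X0 j i -> (u j i < m)%N.
    by have [f fP] := choice H; exists f.
  have /finite_seqP[t tE] := finite_image (u^~ i) (X0fin i).
  exists (\max_(h <- t) h).+1 => j ji; rewrite ltnS.
  have ut : u j i \in t by have : [set` t] (u j i) by rewrite -tE; exists j.
  exact: (@leq_bigmax_seq nat t xpredT id).
have [|y yP] := real (alpha := fun j i => A (m i) (u j i)) (l := l) sJ.
  move=> J0 J0fin.
  have /choice[y yP] : forall i, exists y, forall h, (h < m i)%N ->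
      if `[< exists j, [/\ J0 j, l j & u j i = h] >] then val (A (m i) h) y <= s
      else r <= val (A (m i) h) y.
    by move=> i; exact: (AP (m i) (fun h => `[< exists j, [/\ J0 j, l j & u j i = h] >])).
  exists y => j Jj; have [lj|lj] := boolP (l j).
    apply: filterS (DX j) => i /= ji; have := yP i _ (mP _ _ ji).
    by case: asboolP => // -[]; exists j.
  have H : D (\bigcap_(k in [set k | J0 k /\ l k]) [set i | u k i != u j i]).
    apply: filter_finite => [|k [_ lk]]; last exact: ul.
    by apply: sub_finite_set J0fin => k [].
  apply: filterS2 (DX j) H => i /= ji Hi; have := yP i _ (mP _ _ ji).
  case: asboolP => // -[k [Jk lk e]].
  by have := Hi k (conj Jk lk); rewrite /= e eqxx.
exists (fun i => [set h | val (A (m i) h) (y i) <= s1]) => j.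
apply: filterS (yP j) => i /=; case: (l j) => // h; apply/negP; rewrite -ltNge.
exact: lt_le_trans h.
Qed.

End Cuts.

(** * Filling cuts yields separating sets *)

Section Tree.
Import Order.DefaultSeqLexiOrder.
Implicit Types s t : seq nat.

(* [upper s] is the least upper bound, in the lexicographic order, of the
   extensions of [s]; its value at [[::]] is junk. *)
Fixpoint upper s : seq nat :=
  match s with
  | [::] => [::]
  | x :: s' => if s' is [::] then [:: x.+1] else x :: upper s'
  end.

Lemma prefix_le s t : prefix s t -> (s <= t)%O.
Proof.
elim: s t => [|x s IH] [|y t] //= /andP[/eqP <- /IH st].
by rewrite lexi_cons lexx.
Qed.

Lemma prefix_lt_upper s t : s != [::] -> prefix s t -> (t < upper s)%O.
Proof.
elim: s t => [//|x s IH] [|y t] // _ /= /andP[/eqP <-].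
case: s IH => [_ _|z s IH st]; rewrite ltxi_cons; last by rewrite lexx; exact: IH.
by rewrite !leEnat leqnSn ltnn.
Qed.

(** With the two preceding lemmas: the extensions of a nonempty [s] form exactly the interval from
    [s] up to, but excluding, [upper s]. *)
Lemma upper_le s t : s != [::] -> (s <= t)%O -> ~~ prefix s t -> (upper s <= t)%O.
Proof.
elim: s t => [//|x s IH] [|y t] // _; rewrite lexi_cons => /andP[xy xyst] /=.
rewrite negb_and; case: s IH xyst => [_ _|z s IH xyst].
  rewrite prefix0s orbF => nxy; rewrite lexi_cons le0x implybT andbT.
  by rewrite leEnat in xy *; rewrite ltn_neqAle nxy.
rewrite lexi_cons xy; case: eqP => [e|ne] /=; last first.
  move=> _; apply/implyP => yx; exfalso; apply: ne.
  by apply/eqP; rewrite eq_le xy.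
by move: xyst; rewrite e lexx => st np; exact: IH.
Qed.

Lemma prefix_chain_upper (E : seq (seq nat)) :
  (forall s t, s \in E -> t \in E -> prefix s t || prefix t s) ->
  exists v, forall s, s \in E -> prefix s v.
Proof.
(* Keeping [v] in [E] makes it comparable with the next list, so the longer of the two can be
   kept. *)
move=> Ech; suff [v [_ vP]] : exists v, (E = [::] \/ v \in E) /\
    forall s, s \in E -> prefix s v by exists v.
elim: E Ech => [_|s E IH Ech]; first by exists [::]; split=> //; left.
have [|v [vE vP]] := IH.
  by move=> t t' tE t'E; apply: Ech; rewrite in_cons ?tE ?t'E orbT.
case: vE => [E0|vE].
  exists s; split; first by right; rewrite mem_head.
  by move=> t; rewrite E0 inE => /eqP ->; exact: prefix_refl.
have /orP[sv|vs] : prefix s v || prefix v s.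
  by apply: Ech; rewrite ?mem_head // in_cons vE orbT.
  exists v; split; first by right; rewrite in_cons vE orbT.
  by move=> t; rewrite in_cons => /orP[/eqP -> //|]; exact: vP.
exists s; split; first by right; rewrite mem_head.
move=> t; rewrite in_cons => /orP[/eqP ->|/vP tv]; first exact: prefix_refl.
exact: prefix_trans vs.
Qed.

Context {I : Type} (D : set_system I) (UD : UltraFilter D).
Context (Iinf : infinite_set [set: I]) (regD : regular D) (cuts : fills_cuts D).

Definition extends (e v : I -> seq nat) : Prop := D [set i | prefix (e i) (v i)].

Lemma extends_refl e : extends e e.
Proof. by apply: filterS filterT => i _; exact: prefix_refl. Qed.

(* A cut between the nodes and their upper ends is filled by an internal set of
   nodes any two of which are comparable. *)
Lemma chain_upper_bound (J : Type) (e : J -> I -> seq nat) : small I J ->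
  (forall j, D [set i | e j i != [::]]) ->
  (forall j k, extends (e j) (e k) \/ extends (e k) (e j)) ->
  exists v, forall j, extends (e j) v.
Proof.
move=> sJ e0 ech.
have [X0 [DX X0fin]] := regular_family regD sJ.
pose x (p : J * bool) i := if p.2 then e p.1 i else upper (e p.1 i).
have [|W [Wdown WP]] := cuts (x := x) (l := snd) (small_prod_bool Iinf sJ).
  (* Whichever of two nodes is longer, the first lies below the upper end of the second. *)
  move=> [j b] [k c] /= -> /negbTE ->; rewrite /x /=.
  have [jk|kj] := ech j k.
    apply: filterS2 jk (e0 k) => i /= jk k0.
    exact: le_lt_trans (prefix_le jk) (prefix_lt_upper k0 (prefix_refl _)).
  by apply: filterS2 kj (e0 k) => i /= kj k0; exact: prefix_lt_upper.
(* These are the active nodes at which the cut is right. If neither of two such nodes were a prefix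
   of the other, the upper end of the smaller would lie below the larger, hence in [W]. *)
pose G i := [set s | [/\ exists2 j, X0 j i & e j i = s, s != [::], W i s & ~ W i (upper s)]].
have /choice[v vP] : forall i, exists v, forall s, G i s -> prefix s v.
  move=> i; have /finite_seqP[E EE] : finite_set (G i).
    apply: sub_finite_set (finite_image (e ^~ i) (X0fin i)) => s [[j ji <-] _ _ _].
    by exists j.
  have EG s : s \in E -> G i s by move=> sE; rewrite EE.
  have [|v vP] := @prefix_chain_upper E; last first.
    by exists v => s; rewrite EE; exact: vP.
  move=> s t /EG[_ s0 Ws nWs] /EG[_ t0 Wt nWt].
  wlog st : s t s0 t0 Ws Wt nWs nWt / (s <= t)%O => [H|].
    by have [|/ltW] := leP s t => /H; [apply | rewrite orbC; apply].
  apply/orP; left; apply: contrapT => /negP nst.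
  exact: nWs (Wdown _ _ _ (upper_le s0 st nst) Wt).
exists v => j; apply: filterS2 (filterI (DX j) (e0 j))
  (filterI (WP (j, true)) (WP (j, false))) => i /= [ji j0] [W1 W2]; apply: vP.
by split=> //; exists j.
Qed.

(** An upper bound [v] may contain elements to be avoided, but only after every [e j]. So the
    lengths of the [e j] lie before the positions of these elements in [v], and filling this cut
    tells where to truncate. *)
Lemma chain_upper_bound_avoiding (J C : Type) (e : J -> I -> seq nat)
    (u : C -> I -> nat) : small I J -> small I C ->
  (forall j, D [set i | e j i != [::]]) ->
  (forall j k, extends (e j) (e k) \/ extends (e k) (e j)) ->
  (forall j c, D [set i | u c i \notin e j i]) ->
  exists v, (forall j, extends (e j) v) /\ forall c, D [set i | u c i \notin v i].
Proof.
move=> sJ sC e0 ech eu.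
have [v ev] := chain_upper_bound sJ e0 ech.
(* The successor of the index is the least length of a prefix of [v i] containing [u c i]; if
   [u c i] is not in [v i], it exceeds the size of [v i]. *)
pose x (p : J + C) i := match p with inl j => size (e j i)
                                   | inr c => (index (u c i) (v i)).+1 end.
have [|W [Wdown WP]] := cuts (x := x) (l := fun p => if p is inl _ then true else false)
    (small_sum Iinf sJ sC).
  move=> [j|//] [//|c] _ _; apply: filterS2 (ev j) (eu j c) => i /= /prefixP[t ->] uc.
  by rewrite ltEnat /= ltnS index_cat (negbTE uc) leq_addr.
(* [m i] is the largest length, up to the size of [v i], in the cut, and 0 if there is none. *)
have /choice[m mP] : forall i, exists m, (m = 0%N \/ W i m) /\
    forall n, (n <= size (v i))%N -> W i n -> (n <= m)%N.
  move=> i; have [H|H] := pselect (exists n, (n <= size (v i))%N && `[< W i n >]).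
    have [|m /andP[_ /asboolP Wm] mmax] := @ex_maxnP _ (size (v i)) H.
      by move=> n /andP[].
    exists m; split; first by right.
    by move=> n nv Wn; apply: mmax; rewrite nv; exact/asboolP.
  exists 0%N; split=> [|n nv Wn]; first by left.
  by exfalso; apply: H; exists n; rewrite nv; exact/asboolP.
exists (fun i => take (m i) (v i)); split=> [j|c].
  apply: filterS2 (ev j) (WP (inl j)) => i /= jv Wj.
  have [_ /(_ (size (e j i)) _ Wj) jm] := mP i.
  have [t vt] := prefixP jv; move: jm; rewrite vt size_cat leq_addr => /(_ isT) jm.
  by rewrite take_cat ltnNge jm; exact: prefix_prefix.
apply: filterS (WP (inr c)) => i /= nW; apply/negP => uc.
have [[m0|Wm] _] := mP i; first by rewrite m0 take0 in uc.
apply: nW; apply: Wdown Wm.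
exact: index_ltn uc.
Qed.

Lemma fills_cuts_separates : separates D.
Proof.
move=> C u l sC ul.
have sub (P : C -> Prop) : small I {c | P c}.
  by have [f fi] := sC; exists (fun c => f (proj1_sig c)) => c d /fi /proj1_sig_inj.
(* A clique for [Q] is a chain of nodes; the second clause allows one node per index in [C], which
   keeps the chain small. *)
pose Q (p q : C * (I -> seq nat)) := [/\
  [/\ l p.1, D [set i | u p.1 i \in p.2 i] &
      forall c, ~~ l c -> D [set i | u c i \notin p.2 i]],
  p.1 = q.1 -> p = q & extends p.2 q.2 \/ extends q.2 p.2].
have [H [HQ Hmax]] := maximal_clique Q.
have [v [Hv uv]] : exists v, (forall p, H p -> extends p.2 v) /\
    forall c, ~~ l c -> D [set i | u c i \notin v i].
  have sH : small I {p | H p}.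
    have [f fi] := sC; exists (fun p => f (proj1_sig p).1) => -[p Hp] [q Hq] /fi /= pq.
    by apply: proj1_sig_inj; have [_ pq1 _] := HQ _ _ Hp Hq; exact: pq1.
  have [|||v [Hv uv]] := @chain_upper_bound_avoiding _ _ (fun p : {p | H p} => (proj1_sig p).2)
      (fun c : {c | ~~ l c} => u (proj1_sig c)) sH (sub _).
  - move=> [p Hp] /=; have [[_ + _] _ _] := HQ _ _ Hp Hp.
    by apply: filterS => i /=; apply: contraTneq => ->.
  - by move=> [p Hp] [q Hq] /=; have [_ _] := HQ _ _ Hp Hq.
  - by move=> [p Hp] [c lc] /=; have [[_ _ +] _ _] := HQ _ _ Hp Hp; apply.
  - exists v; split=> [p Hp|c lc]; first exact: (Hv (exist _ p Hp)).
    exact: (uv (exist _ c lc)).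
have Hall c : l c -> exists2 p, H p & p.1 = c.
  move=> lc; apply: contrapT => nH.
  (* Appending the missing element to the upper bound [v] would extend the maximal chain. *)
  pose q : C * (I -> seq nat) := (c, fun i => rcons (v i) (u c i)).
  have Qq : [/\ l q.1, D [set i | u q.1 i \in q.2 i] &
      forall c, ~~ l c -> D [set i | u c i \notin q.2 i]].
    split=> //=; first by apply: filterS filterT => i _; rewrite /= mem_rcons mem_head.
    move=> d nld; apply: filterS2 (uv d nld) (ul c d lc nld) => i /= dv cd.
    by rewrite mem_rcons in_cons negb_or eq_sym cd.
  apply: (nH); exists q => //; apply: Hmax.
    by split=> //; left; exact: extends_refl.
  move=> y Hy; have [Qy _ _] := HQ _ _ Hy Hy.
  have yq : extends y.2 q.2.
    by apply: filterS (Hv y Hy) => i /= yv; apply: prefix_trans (prefix_rcons _ _).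
  have ny : c <> y.1 by move=> cy; apply: nH; exists y.
  split; first by split=> [||] //; right.
  by split=> //; [move/esym | left].
exists (fun i => [set h | h \in v i]) => c; case: (boolP (l c)) => lc; last first.
  by apply: filterS (uv c lc) => i /= /negP.
have [p Hp pc] := Hall c lc; have [[_ + _] _ _] := HQ _ _ Hp Hp.
apply: filterS2 (Hv p Hp) => i /= /prefixP[t ->].
by rewrite pc mem_cat => ->.
Qed.

End Tree.

(** * Separation from instability *)

Lemma unstable_separates (R : realType) (V : vocabulary R) (T : set (formula V))
    (I : Type) (D : set_system I) (UD : UltraFilter D) :
  unstable T -> Sat T UD -> separates D.
Proof.
move=> [phi [xs [s [r [s0 sr r1 [M [MT [a [b ab]]]]]]]]] [Iinf regD sat].
have mM : metric_structure M by case: MT.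
pose val := @split_value R V M phi xs.
have real t q t' q' : 0 <= t <= 1 -> 0 <= q <= 1 -> t < t' -> q' < q ->
    realizes D val t q t' q'.
  move=> t01 q01 tt' q'q J alpha l sJ.
  exact: (realize mM Iinf sJ (sat _ MT) t01 q01 tt' q'q).
(* Each use of [realize] moves the thresholds inward: bounded alternation passes from [s], [r] to
   [s1], [r1']; independence starts at these and passes to [s2], [r2]. *)
pose s1 := (3 * s + r) / 4; pose r1' := (s + 3 * r) / 4.
pose s2 := (5 * s + 3 * r) / 8; pose r2 := (3 * s + 5 * r) / 8.
(* The order property says nothing about the pair (a_h, b_h); taking [a] at odd indices and [b] at
   even ones avoids equal indices. *)
pose Lo y h := val (a h.*2.+1) y <= s1; pose Hi y h := r1' <= val (a h.*2.+1) y.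
have LH y h : Lo y h -> ~ Hi y h by rewrite /Lo /Hi /s1 /r1' => ? ?; lra.
have [ip|[K nip]] := independence_or_bounded_alternation LH.
- have real2 : realizes D val s1 r1' s2 r2.
    by apply: real; rewrite /s1 /r1' /s2 /r2; try (apply/andP; split); lra.
  apply: (independence_separates UD regD real2) => [|m]; first by rewrite /s2 /r2; lra.
  by have [f fP] := ip m; exists (fun h => a (f h).*2.+1) => w;
    have [y yP] := fP w; exists y => h /yP; case: (w h).
- have real1 : realizes D val s r s1 r1'.
    by apply: real; rewrite /s1 /r1'; try (apply/andP; split); lra.
  apply: (fills_cuts_separates UD Iinf regD).
  apply: (bounded_alternation_fills_cuts UD regD real1 (K := K)) => n.
  have [f [finc fP]] := nip n.
  exists (fun h => a (f h).*2.+1), (fun k => b (f k).*2); split=> [h k hk kn|h k kh hn|//].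
    have [] := ab (f h).*2.+1 (f k).*2 => //.
    by rewrite -doubleS leq_double; exact: finc.
  have [] := ab (f k).*2 (f h).*2.+1 => //.
  rewrite ltnS leq_double; move: kh; rewrite leq_eqVlt => /orP[/eqP -> //|kh].
  exact/ltnW/finc.
Qed.

(** * Saturation of random graphs *)

Section Graphs.
Context {R : realType}.
Implicit Types S : structure (@graph_vocabulary R).

Definition pair_fun (T : Type) (x y : T) : 'I_2 -> T :=
  fun i => if i == ord0 then x else y.

Lemma pair_funE (T : Type) (a : 'I_2 -> T) : a = pair_fun (a ord0) (a ord_max).
Proof.
by apply/funext => -[[|[|//]] lt]; rewrite /pair_fun /=; congr a; exact/val_inj.
Qed.

Definition edge S (x y : S) : Prop := pint S tt (pair_fun x y) = 0.

Definition discrete_graph S : Prop :=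
  [/\ forall a : 'I_2 -> S, pint S tt a = 0 \/ pint S tt a = 1,
      forall x y : S, dist x y = 0 \/ dist x y = 1,
      forall x y : S, dist x y = 0 <-> x = y,
      forall x y : S, edge x y -> edge y x &
      forall x : S, ~ edge x x].

(** The extension property for up to |I| vertices at once. Labels sit on indices, so repeated
    vertices must agree. *)
Definition rich (I : Type) S : Prop :=
  forall (J : Type) (c : J -> S) (P : J -> Prop), small I J ->
  (forall j k, c j = c k -> P j -> P k) ->
  exists z, forall j, (edge z (c j) <-> P j) /\ z <> c j.

Section Ultrapower.
Context {I : Type} (D : set_system I) (UD : UltraFilter D).
Variable N : structure (@graph_vocabulary R).
Hypotheses (mN : metric_structure N) (dN : discrete_graph N).
Local Notation U := (ultrapower UD N).

Lemma ulim_discrete (h : I -> R) : (forall i, h i = 0 \/ h i = 1) ->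
  D [set i | h i = 0] /\ ulim D h = 0 \/ D [set i | h i <> 0] /\ ulim D h = 1.
Proof.
move=> h01; have [H|H] := ultra_dec UD [set i | h i = 0]; [left|right].
  split=> //; apply: ulim_unique => e e0.
  by apply: filterS H => i /= ->; rewrite subrr normr0.
split=> //; apply: ulim_unique => e e0; apply: filterS H => i /=.
by case: (h01 i) => -> // _; rewrite subrr normr0.
Qed.

Lemma ulim_discrete_eq0 (h : I -> R) : (forall i, h i = 0 \/ h i = 1) ->
  ulim D h = 0 <-> D [set i | h i = 0].
Proof.
move=> /ulim_discrete [[H ->]|[H ->]]; first by [].
split=> [/eqP|H0]; first by rewrite oner_eq0.
by have [i [/= ]] := filter_ex (filterI H0 H).
Qed.

Lemma edge_ultrapower (x y : U) :
  edge x y <-> D [set i | edge (urepr x i) (urepr y i)].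
Proof.
have [pN _ _ _ _] := dN.
rewrite /edge /= /upint ulim_discrete_eq0 => [|i]; last exact: pN.
have E i : (fun j => urepr (pair_fun x y j) i) = pair_fun (urepr x i) (urepr y i).
  by apply/funext => j; rewrite /pair_fun; case: eqP.
by split; apply: filterS => i; rewrite /= E.
Qed.

Lemma eq_ultrapower (x y : U) : x = y <-> D [set i | urepr x i = urepr y i].
Proof.
have [_ dN01 dNE _ _] := dN.
split=> [->|H]; first exact: filterS filterT.
rewrite -[x]upi_urepr // -[y]upi_urepr //; apply: proj1_sig_inj => /=.
apply/seteqP; split=> f /=; rewrite /uclass /=.
all: move/ulim_discrete_eq0 => /(_ (fun i => dN01 _ _)) Hf.
all: apply/ulim_discrete_eq0 => [i|]; first exact: dN01.
all: by apply: filterS2 H Hf => i /= ->.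
Qed.

Lemma discrete_ultrapower : discrete_graph U.
Proof.
have [pN dN01 dNE sN iN] := dN.
split=> [a|x y|x y|x y|x].
- have [[_ H]|[_ H]] := ulim_discrete (fun i => pN (fun j => urepr (a j) i));
  by [left; exact: H | right; exact: H].
- have [[_ H]|[_ H]] := ulim_discrete (fun i => dN01 (urepr x i) (urepr y i));
  by [left; exact: H | right; exact: H].
- rewrite eq_ultrapower /= /udist ulim_discrete_eq0 => [|i]; last exact: dN01.
  by split; apply: filterS => i /= /dNE.
- by move=> /edge_ultrapower H; apply/edge_ultrapower; apply: filterS H => i; exact: sN.
- by move=> /edge_ultrapower /filter_ex[i]; exact: iN.
Qed.

Lemma urepr_upi_discrete (f : I -> N) : D [set i | urepr (upi D f) i = f i].
Proof.
have [_ dN01 dNE _ _] := dN.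
apply: filterS (urepr_upi UD mN f ltr01) => i /=.
by have [/dNE -> //|->] := dN01 (f i) (urepr (upi D f) i); rewrite ltxx.
Qed.

(** [separates] speaks of naturals, so the finitely many vertices active at each coordinate are
    numbered. The separating set then prescribes, at each coordinate, an instance of the extension
    axiom in [N]. *)
Lemma rich_ultrapower : infinite_set [set: I] -> regular D -> separates D ->
  (forall X Y : set N, finite_set X -> finite_set Y -> X `&` Y = set0 ->
     exists z, (forall x, X x -> edge z x) /\ (forall y, Y y -> ~ edge z y)) ->
  rich I U.
Proof.
move=> Iinf regD sep extN.
have weak (J : Type) (c : J -> U) (P : J -> Prop) : small I J ->
    (forall j k, c j = c k -> P j -> P k) -> exists z, forall j, edge z (c j) <-> P j.
  move=> sJ cP; have [X0 [DX X0fin]] := regular_family regD sJ.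
  have /choice[code codeP] : forall i, exists f : N -> nat,
      forall j k, X0 j i -> X0 k i -> f (urepr (c j) i) = f (urepr (c k) i) ->
      urepr (c j) i = urepr (c k) i.
    move=> i; have /finite_set_countable/pcard_injP[f fi] :=
      finite_image (fun j => urepr (c j) i) (X0fin i).
    exists f => j k ji ki; apply: fi; rewrite inE; [by exists j | by exists k].
  pose u j i := code i (urepr (c j) i).
  have [|S SP] := @sep J u (fun j => `[< P j >]) sJ.
    move=> j k /asboolP Pj /asboolPn nPk.
    have : ~ c j = c k by move=> e; apply/nPk/(cP j).
    rewrite eq_ultrapower => /(ultraN UD).
    apply: filterS2 (filterI (DX j) (DX k)) => i /= [ji ki] ne.
    by apply/eqP => e; apply: ne; exact: codeP e.
  have /choice[z zP] : forall i, exists z, forall j, X0 j i ->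
      (edge z (urepr (c j) i) <-> S i (u j i)).
    move=> i.
    have fin (B : set nat) :
        finite_set [set y | exists j, [/\ X0 j i, B (u j i) & urepr (c j) i = y]].
      apply: sub_finite_set (finite_image (fun j => urepr (c j) i) (X0fin i)).
      by move=> _ [j [ji _ <-]]; exists j.
    have [|z [z1 z2]] := extN _ _ (fin (S i)) (fin (~` S i)).
      apply/seteqP; split=> // y [[j [_ Sj e]] [k [_ nSk e']]].
      by apply: nSk; rewrite /u e' -e.
    exists z => j ji; have [Sj|nSj] := pselect (S i (u j i)).
      by split=> // _; apply: z1; exists j.
    by split=> // e; exfalso; apply: (z2 (urepr (c j) i)) => //; exists j.
  exists (upi D z) => j; rewrite edge_ultrapower.
  have H : D [set i | urepr (upi D z) i = z i /\ X0 j i].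
    exact: filterI (urepr_upi_discrete z) (DX j).
  split=> [De|Pj].
    have := SP j; case: asboolP => // _ Dn.
    have [i [/= ]] := filter_ex (filterI (filterI De Dn) H).
    by move=> [e nS] [zi ji]; exfalso; apply: nS; apply/(zP i j ji); rewrite -zi.
  have := SP j; case: asboolP => // _; apply: filterS2 H => i /= [-> ji] Si.
  exact/(zP i j ji).
move=> J c P sJ cP.
have [_ _ _ sU iU] := discrete_ultrapower.
(* [e] is adjacent to every [c j]; a [z] not adjacent to [e] therefore differs from every [c j]. *)
have [e eP] := weak J c (fun _ => True) sJ (fun _ _ _ _ => Logic.I).
have s1 : small I unit.
  by have [i0 _] := infinite_setN0 Iinf; exists (fun _ => i0) => -[] [].
have [|z zP] := weak (J + unit)%type
  (fun p => match p with inl j => c j | inr _ => e end)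
  (fun p => match p with inl j => P j | inr _ => False end) (small_sum Iinf sJ s1).
  move=> [j|[]] [k|[]] //=; first exact: cP.
  by move=> cje; exfalso; apply: (iU e); rewrite -{2}cje; exact/eP.
exists z => j; split; first exact: (zP (inl j)).
move=> zj; have [+ _] := zP (inr tt); apply.
by apply: sU; rewrite zj; apply/eP.
Qed.

End Ultrapower.
End Graphs.

(** * Models of the theory of the random graph *)

Section Closure.
Context {R : realType} {V : vocabulary R}.
Implicit Types (phi psi : formula V) (M : structure V).

Lemma ord_bound n (P : 'I_n -> nat -> Prop) :
  (forall i, exists k, forall x, P i x -> (x < k)%N) ->
  exists k, forall i x, P i x -> (x < k)%N.
Proof.
move=> /choice[f fP]; exists (\max_i f i)%N => i x /fP xf.
exact: leq_trans xf (leq_bigmax _).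
Qed.

Lemma term_vars_bound (t : term V) : exists k, forall x, term_vars t x -> (x < k)%N.
Proof.
elim: t => [y|f ts IH] /=; first by exists y.+1 => x ->.
by have [k kP] := ord_bound IH; exists k => x [i _]; exact: kP.
Qed.

Lemma free_vars_bound phi : exists k, forall x, free_vars phi x -> (x < k)%N.
Proof.
elim: phi => [p ts|t u|n c phis IH|y psi [k kP]|y psi [k kP]] /=.
- have [k kP] := ord_bound (fun i => term_vars_bound (ts i)).
  by exists k => x [i _]; exact: kP.
- have [k kP] := term_vars_bound t; have [m mP] := term_vars_bound u.
  by exists (maxn k m) => x [/kP|/mP]; rewrite leq_max => ->; rewrite ?orbT.
- by have [k kP] := ord_bound IH; exists k => x [i _]; exact: kP.
- by exists k => x [/kP].
- by exists k => x [/kP].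
Qed.

Lemma free_vars_sups l phi x :
  free_vars (foldr (@Sup R V) phi l) x -> free_vars phi x /\ x \notin l.
Proof.
elim: l => //= y l IH [/IH[px xl] /= xy]; split=> //.
by rewrite in_cons negb_or xl andbT; apply/eqP.
Qed.

Lemma value_sups_eq0 M l phi : (forall v : nat -> M, value v phi = 0) ->
  forall v : nat -> M, value v (foldr (@Sup R V) phi l) = 0.
Proof.
move=> H; elim: l => //= y l IH v; apply/eqP; rewrite eq_le.
have /andP[-> _] := value01 v (Sup y (foldr (@Sup R V) phi l)); rewrite andbT.
by apply: value_sup_le => a; rewrite IH.
Qed.

Lemma sups_eq0_value M l phi (v : nat -> M) :
  value v (foldr (@Sup R V) phi l) = 0 -> value v phi = 0.
Proof.
elim: l => [//|y l IH] H; apply: IH; apply/eqP; rewrite eq_le.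
have /andP[-> _] := value01 v (foldr (@Sup R V) phi l); rewrite andbT -H.
have {1}-> : v = update v y (v y).
  by apply/funext => z; rewrite /update; case: eqP => [->|].
exact: value_sup_ge.
Qed.

End Closure.

(** * Boolean connectives as continuous ones, with value 0 as truth *)

Section Connectives.
Context {R : realType}.

Lemma neg_continuous :
  {within @unit_cube R 1, continuous (fun x : 'rV[R]_1 => 1 - x ord0 ord0)}.
Proof.
apply: continuous_subspaceT => x.
have H : (fun y : 'rV[R]_1 => y ord0 ord0) @ x --> x ord0 ord0 by exact: coord_continuous.
exact: (cvgB (cvg_cst _) H).
Qed.

Lemma neg01 (x : 'rV[R]_1) : unit_cube x -> 0 <= 1 - x ord0 ord0 <= 1.
Proof. by move=> /(_ ord0) /andP[? ?]; apply/andP; split; lra. Qed.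

Lemma or_continuous : {within @unit_cube R 2,
  continuous (fun x : 'rV[R]_2 => x ord0 ord0 * x ord0 ord_max)}.
Proof.
apply: continuous_subspaceT => x.
have H i : (fun y : 'rV[R]_2 => y ord0 i) @ x --> x ord0 i by exact: coord_continuous.
exact: (cvgM (H ord0) (H ord_max)).
Qed.

Lemma or01 (x : 'rV[R]_2) : unit_cube x -> 0 <= x ord0 ord0 * x ord0 ord_max <= 1.
Proof.
move=> x01; have /andP[? ?] := x01 ord0; have /andP[? ?] := x01 ord_max.
by apply/andP; split; [exact: mulr_ge0 | exact: mulr_ile1].
Qed.

Definition neg_conn : connective R 1 := Connective neg_continuous neg01.
Definition or_conn : connective R 2 := Connective or_continuous or01.

Context {V : vocabulary R}.

Definition Neg (phi : formula V) : formula V := Conn neg_conn (fun=> phi).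
Definition Or (phi psi : formula V) : formula V :=
  Conn or_conn (fun i => if i == ord0 then phi else psi).
Definition And (phi psi : formula V) : formula V := Neg (Or (Neg phi) (Neg psi)).

Section Values.
Context (M : structure V).
Implicit Types (phi psi : formula V) (v : nat -> M).

Lemma value_neg v phi : value v (Neg phi) = 1 - value v phi.
Proof. by rewrite /= mxE. Qed.

Lemma value_or v phi psi : value v (Or phi psi) = value v phi * value v psi.
Proof. by rewrite /= !mxE. Qed.

Definition two_valued phi : Prop := forall v, value v phi = 0 \/ value v phi = 1.

Lemma two_valued_neg phi : two_valued phi -> two_valued (Neg phi).
Proof.
by move=> H v; rewrite value_neg; have [->|->] := H v; rewrite ?subrr ?subr0; [right|left].
Qed.

Lemma two_valued_or phi psi : two_valued phi -> two_valued psi -> two_valued (Or phi psi).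
Proof.
move=> H K v; rewrite value_or.
by have [->|->] := H v; rewrite ?mul0r ?mul1r; [left|exact: K].
Qed.

Lemma two_valued_and phi psi : two_valued phi -> two_valued psi -> two_valued (And phi psi).
Proof. by move=> H K; apply/two_valued_neg/two_valued_or; exact: two_valued_neg. Qed.

Lemma value_or_eq0 v phi psi :
  value v (Or phi psi) = 0 <-> value v phi = 0 \/ value v psi = 0.
Proof.
rewrite value_or; split=> [/eqP|[]->]; rewrite ?mul0r ?mulr0 //.
by rewrite mulf_eq0 => /orP[]/eqP ->; [left|right].
Qed.

Lemma value_and_eq0 v phi psi :
  value v (And phi psi) = 0 <-> value v phi = 0 /\ value v psi = 0.
Proof.
rewrite /And value_neg value_or !value_neg.
have /andP[? ?] := value01 v phi; have /andP[? ?] := value01 v psi.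
split=> [H|[-> ->]]; last by rewrite !subr0 mulr1 subrr.
by split; nra.
Qed.

End Values.
End Connectives.

Section RandomGraphModels.
Context {R : realType}.
Local Notation L := (@graph_vocabulary R).

(** [T_rg] contains only sentences, so an open formula passes to [N] through its universal closure,
    by suprema over all variables below a bound. *)
Lemma model_valid (phi : formula L) (N : structure L) : model (@T_rg R) N ->
  (forall (G : Type) (G0 : inhabited G) (E : G -> G -> Prop), random_graph E ->
     forall v : nat -> graph_structure G0 E, value v phi = 0) ->
  forall v : nat -> N, value v phi = 0.
Proof.
move=> [_ NT] H v; have [k kP] := free_vars_bound phi.
apply: (@sups_eq0_value _ _ _ (iota 0 k)); apply: NT; split.
  apply/seteqP; split=> // x /free_vars_sups[/kP xk].
  by rewrite mem_iota /= xk.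
by move=> G G0 E rgE; apply: value_sups_eq0; exact: H.
Qed.

Definition Edge (x y : nat) : formula L := @Pred R L tt (pair_fun (Var _ x) (Var _ y)).
Definition Eq (x y : nat) : formula L := @Dist R L (Var _ x) (Var _ y).

Lemma value_edge (S : structure L) (v : nat -> S) x y :
  value v (Edge x y) = pint S tt (pair_fun (v x) (v y)).
Proof.
by rewrite /=; congr pint; apply/funext => i; rewrite /pair_fun; case: eqP.
Qed.

Lemma truth_eq0 (P : Prop) : @truth R P = 0 <-> P.
Proof.
rewrite /truth; case: asboolP => // nP; split=> // /eqP; by rewrite oner_eq0.
Qed.

Lemma truth_two_valued (P : Prop) : @truth R P = 0 \/ @truth R P = 1.
Proof. by rewrite /truth; case: ifP; [left|right]. Qed.

Lemma value_neg_eq0 (S : structure L) (v : nat -> S) (phi : formula L) :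
  two_valued S phi -> value v (Neg phi) = 0 <-> value v phi <> 0.
Proof.
move=> /(_ v); rewrite value_neg => -[->|->]; rewrite ?subr0 ?subrr; split=> //.
  by move/eqP; rewrite oner_eq0.
by move=> _ /eqP; rewrite oner_eq0.
Qed.

Lemma value_ands_eq0 (X : eqType) (S : structure L) (v : nat -> S) f phi (s : seq X) :
  value v (foldr And phi [seq f x | x <- s]) = 0 <->
  value v phi = 0 /\ forall x, x \in s -> value v (f x) = 0.
Proof.
elim: s => [|y s IH]; first by split=> [|[]].
rewrite [map _ _]/= [foldr _ _ _]/= value_and_eq0 IH; split.
  by move=> [fy [p0 fs]]; split=> // x; rewrite in_cons => /orP[/eqP -> //|]; exact: fs.
move=> [p0 fs]; split; first by apply: fs; exact: mem_head.
by split=> // x xs; apply: fs; rewrite in_cons xs orbT.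
Qed.

Lemma value_ors_eq0 (X : eqType) (S : structure L) (v : nat -> S) f phi (s : seq X) :
  value v (foldr Or phi [seq f x | x <- s]) = 0 <->
  value v phi = 0 \/ exists2 x, x \in s & value v (f x) = 0.
Proof.
elim: s => [|y s IH]; first by split=> [|[|[]]] //; left.
rewrite [map _ _]/= [foldr _ _ _]/= value_or_eq0 IH; split.
  move=> [fy|[p0|[x xs fx]]]; [right|by left|right].
    by exists y => //; exact: mem_head.
  by exists x => //; rewrite in_cons xs orbT.
move=> [p0|[x]]; first by right; left.
rewrite in_cons => /orP[/eqP -> fy|xs fx]; first by left.
by right; right; exists x.
Qed.

Lemma two_valued_foldr (X : Type) (S : structure L) (op : formula L -> formula L -> formula L)
    f phi (s : seq X) :
  (forall psi chi, two_valued S psi -> two_valued S chi -> two_valued S (op psi chi)) ->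
  (forall x, two_valued S (f x)) -> two_valued S phi ->
  two_valued S (foldr op phi [seq f x | x <- s]).
Proof. by move=> H fP p0; elim: s => //= x s IH; apply: H. Qed.

Section Discrete.
Variables (S : structure L) (dS : discrete_graph S).

Lemma two_valued_edge x y : two_valued S (Edge x y).
Proof. by move=> v; rewrite value_edge; case: dS => + _ _ _ _; apply. Qed.

Lemma two_valued_eq x y : two_valued S (Eq x y).
Proof. by move=> v; case: dS => _ + _ _ _; apply. Qed.

Lemma value_eq_eq0 (v : nat -> S) x y : value v (Eq x y) = 0 <-> v x = v y.
Proof. by case: dS => _ _ + _ _; apply. Qed.

End Discrete.

(* Says that [x_0] is adjacent to every [x_p] with [p] in [ps], and not adjacent
   to any [x_q] with [q] in [qs] other than the [x_p]. *)
Definition ext_body (ps qs : seq nat) : formula L :=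
  foldr And (foldr And (Eq 0 0)
    [seq Or (Neg (Edge 0 q)) (foldr Or (Neg (Eq 0 0)) [seq Eq q p | p <- ps]) | q <- qs])
    [seq Edge 0 p | p <- ps].

Lemma two_valued_ext_body (S : structure L) ps qs : discrete_graph S ->
  two_valued S (ext_body ps qs).
Proof.
move=> dS; apply: two_valued_foldr; first exact: two_valued_and.
  by move=> p; exact: two_valued_edge.
apply: two_valued_foldr; [exact: two_valued_and| |exact: two_valued_eq].
move=> q; apply: two_valued_or; first exact/two_valued_neg/two_valued_edge.
apply: two_valued_foldr; [exact: two_valued_or| |].
  by move=> p; exact: two_valued_eq.
exact/two_valued_neg/two_valued_eq.
Qed.

Lemma ext_body_eq0 (S : structure L) (v : nat -> S) ps qs : discrete_graph S ->
  value v (ext_body ps qs) = 0 <->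
  (forall p, p \in ps -> edge (v 0%N) (v p)) /\
  (forall q, q \in qs -> ~ edge (v 0%N) (v q) \/ exists2 p, p \in ps & v q = v p).
Proof.
move=> dS; rewrite !value_ands_eq0.
have eP x y : value v (Edge x y) = 0 <-> edge (v x) (v y) by rewrite value_edge.
have qP q : value v (Or (Neg (Edge 0 q)) (foldr Or (Neg (Eq 0 0)) [seq Eq q p | p <- ps])) = 0
    <-> ~ edge (v 0%N) (v q) \/ exists2 p, p \in ps & v q = v p.
  rewrite value_or_eq0 value_ors_eq0 !value_neg_eq0 ?eP ?value_eq_eq0 //;
    [|exact: two_valued_eq|exact: two_valued_edge].
  split=> [[H|[H|[p pps /value_eq_eq0 H]]]|[H|[p pps H]]]; [by left|by []| |by left|].
    by right; exists p => //; exact: H.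
  by right; right; exists p => //; exact/value_eq_eq0.
split=> [[[_ H1] H2]|[H1 H2]].
  by split=> [p /H2/eP|q /H1/qP].
split; last by move=> p /H1/eP.
by split=> [|q /H2/qP]; first exact/value_eq_eq0.
Qed.

Lemma edge_graph_structure (G : Type) (G0 : inhabited G) (E : G -> G -> Prop)
    (x y : @graph_structure R G G0 E) : edge x y <-> E x y.
Proof. exact: truth_eq0. Qed.

Lemma discrete_graph_structure (G : Type) (G0 : inhabited G) (E : G -> G -> Prop) :
  random_graph E -> discrete_graph (@graph_structure R G G0 E).
Proof.
move=> [sE iE _]; split=> [a|x y|x y|x y|x].
- exact: truth_two_valued.
- exact: truth_two_valued.
- exact: truth_eq0.
- by move=> /edge_graph_structure xy; apply/edge_graph_structure/sE.
- by move=> /edge_graph_structure; exact: iE.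
Qed.

(** The third clause is a metric axiom; the others come from valid open formulas. Values are 0 or 1
    because excluded middle for a value x is the product of x and 1 - x, which must vanish. *)
Lemma discrete_model (N : structure L) : model (@T_rg R) N -> discrete_graph N.
Proof.
move=> mN; have [[[dN _ _] _ _] _] := mN.
pose v2 (x y : N) (k : nat) := if k == 0%N then x else y.
have valid := model_valid mN.
have H1 x y : pint N tt (pair_fun x y) = 0 \/ pint N tt (pair_fun x y) = 1.
  have /value_or_eq0 : value (v2 x y) (Or (Edge 0 1) (Neg (Edge 0 1))) = 0.
    apply: valid => G G0 E /(discrete_graph_structure G0) dG v.
    rewrite value_or_eq0 value_neg_eq0; last exact: two_valued_edge.
    exact: EM.
  rewrite value_neg value_edge => -[|/eqP]; first by left.
  by rewrite subr_eq0 eq_sym => /eqP; right.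
split=> [a|x y|x y|x y xy|x xx].
- by rewrite (pair_funE a).
- have /value_or_eq0 : value (v2 x y) (Or (Eq 0 1) (Neg (Eq 0 1))) = 0.
    apply: valid => G G0 E /(discrete_graph_structure G0) dG v.
    rewrite value_or_eq0 value_neg_eq0; last exact: two_valued_eq.
    exact: EM.
  rewrite value_neg => -[|/eqP]; first by left.
  by rewrite subr_eq0 eq_sym => /eqP; right.
- exact: dN.
- have /value_or_eq0 : value (v2 x y) (Or (Neg (Edge 0 1)) (Edge 1 0)) = 0.
    apply: valid => G G0 E rgE v; have dG := discrete_graph_structure G0 rgE.
    rewrite value_or_eq0 value_neg_eq0; last exact: two_valued_edge.
    rewrite !value_edge; have [e|] := pselect (edge (v 0%N) (v 1%N)); last by left.
    by right; case: dG => _ _ _ + _; apply.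
  rewrite value_neg !value_edge => -[/eqP|//].
  by rewrite [pint _ _ _]xy subr0 oner_eq0.
- have : value (v2 x x) (Neg (Edge 0 0)) = 0.
    apply: valid => G G0 E rgE v; have dG := discrete_graph_structure G0 rgE.
    rewrite value_neg_eq0; last exact: two_valued_edge.
    by rewrite value_edge; case: dG => _ _ _ _; apply.
  by move/eqP; rewrite value_neg value_edge [pint _ _ _]xx subr0 oner_eq0.
Qed.

(** The body excuses each x_q that coincides with some x_p, so in a random graph its infimum over
    x_0 is 0 under every valuation, which transfers to [N]. Disjointness of [X] and [Y] finally
    rules the excuse out. *)
Lemma extension_model (N : structure L) : model (@T_rg R) N ->
  forall X Y : set N, finite_set X -> finite_set Y -> X `&` Y = set0 ->
    exists z, (forall x, X x -> edge z x) /\ (forall y, Y y -> ~ edge z y).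
Proof.
move=> mN X Y /(@finite_seqP {classic N})[sx XE] /(@finite_seqP {classic N})[sy YE] XY.
have dN := discrete_model mN.
case: (carrier_inhabited N) => a0.
(* Variable 0 is the vertex sought; [X] is listed from variable 1 on, followed by [Y]. *)
pose ps := [seq k.+1 | k <- iota 0 (size sx)].
pose qs := [seq k.+1 | k <- iota (size sx) (size sy)].
pose v k : N := nth (a0 : {classic N}) (sx ++ sy) k.-1.
have : value v (Inf 0 (ext_body ps qs)) = 0.
  apply: (model_valid mN) => G G0 E rgE w.
  have dG := discrete_graph_structure G0 rgE.
  have [_ _ extE] := rgE.
  have fin (P : set nat) (s : seq nat) :
      finite_set [set y : G | exists2 q, q \in s /\ P q & w q = y].
    apply: (@sub_finite_set _ _ (w @` [set` s])).
      by move=> _ [q [qs' _] <-]; exists q.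
    exact/finite_image/finite_seq.
  have [|z [z1 z2]] := extE _ _ (fin setT ps)
      (fin [set q | forall p, p \in ps -> w q <> w p] qs).
    apply/seteqP; split=> // y [[p [pps _] <-] [q [_ H] e]].
    exact: H pps e.
  apply/eqP; rewrite eq_le; have /andP[-> _] := value01 w (Inf 0 (ext_body ps qs)).
  rewrite andbT; apply: (le_trans (value_inf_le w 0 z (ext_body ps qs))).
  have u0 x : x \in ps ++ qs -> update w 0 z x = w x.
    by rewrite mem_cat => /orP[] /mapP[k _ ->].
  have -> // : value (update w 0 z) (ext_body ps qs) = 0.
  apply/ext_body_eq0 => //; split=> [p pps|q qqs].
    rewrite (u0 p) ?mem_cat ?pps //; apply/edge_graph_structure; apply: z1.
    by exists p.
  rewrite (u0 q) ?mem_cat ?qqs ?orbT //.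
  have [[p pps e]|H] := pselect (exists2 p, p \in ps & w q = w p).
    by right; exists p => //; rewrite (u0 p) // mem_cat pps.
  left=> /edge_graph_structure; apply: z2; exists q => //; split=> // p pps e.
  by apply: H; exists p.
(* The infimum is only approached, but a two-valued body with value below 1 vanishes. *)
move=> vE; have [z] := value_inf_adherent v 0 (ext_body ps qs) (@ltr01 R).
rewrite vE add0r => zlt.
have /ext_body_eq0 -/(_ dN)[H1 H2] : value (update v 0 z) (ext_body ps qs) = 0.
  by have [//|e] := two_valued_ext_body ps qs dN (update v 0 z); rewrite e ltxx in zlt.
have sxP x : X x -> exists2 p, p \in ps & update v 0 z p = x.
  rewrite XE => xs; exists (index (x : {classic N}) sx).+1.
    by apply: map_f; rewrite mem_iota /= index_mem.
  by rewrite /update /v /= nth_cat index_mem xs nth_index.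
have psX p : p \in ps -> X (update v 0 z p).
  move=> /mapP[k]; rewrite mem_iota /= => kx ->.
  by rewrite XE /update /v /= nth_cat kx; exact: mem_nth.
exists z; split=> [x /sxP[p pps <-]|y Yy zy]; first exact: H1.
have [q qqs qy] : exists2 q, q \in qs & update v 0 z q = y.
  rewrite YE in Yy; exists (size sx + index (y : {classic N}) sy).+1%N.
    by apply: map_f; rewrite mem_iota leq_addr ltn_add2l index_mem.
  by rewrite /update /v /= nth_cat ltnNge leq_addr addKn nth_index.
have [|[p pps e]] := H2 q qqs; first by rewrite qy.
have : (X `&` Y) y by split=> //; rewrite -qy e; exact: psX.
by rewrite XY.
Qed.

End RandomGraphModels.

(** * Back and forth, and saturation of rich graphs *)

Section Saturate.
Context {R : realType} {I : Type} (Iinf : infinite_set [set: I]).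
Local Notation L := (@graph_vocabulary R).
Variables (S : structure L) (dS : discrete_graph S) (rS : rich I S).

Definition same_type (X : Type) (F : set X) (v w : X -> S) : Prop :=
  forall x y, F x -> F y ->
    (v x = v y <-> w x = w y) /\ (edge (v x) (v y) <-> edge (w x) (w y)).

Lemma same_type_sym (X : Type) (F : set X) (v w : X -> S) :
  same_type F v w -> same_type F w v.
Proof. by move=> vw x y Fx Fy; have [e1 e2] := vw x y Fx Fy; split; apply: iff_sym. Qed.

(** If [a] is already a value of [v] on [F] without [x], then [b] repeats the corresponding value of
    [w]; otherwise richness gives a new [b] with the edges of [a]. *)
Lemma same_type_extend (F : set nat) (v w : nat -> S) x a :
  same_type (F `\ x) v w ->
  exists b, same_type F (update v x a) (update w x b).
Proof.
move=> vw; have [_ _ _ sS iS] := dS.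
have [[y [[Fy yx] ay]]|na] := pselect (exists y, (F `\ x) y /\ a = v y).
  exists (w y) => t u Ft Fu.
  pose f z := if z == x then y else z.
  have fF z : F z -> (F `\ x) (f z).
    by rewrite /f; case: eqP => // zx Fz; split.
  have fv z : update v x a z = v (f z) by rewrite /update /f ay; case: ifP.
  have fw z : update w x (w y) z = w (f z) by rewrite /update /f; case: ifP.
  by rewrite !fv !fw; apply: vw; exact: fF.
have sF : small I {y | (F `\ x) y}.
  by apply: small_trans (small_nat Iinf) _; exists (@proj1_sig _ _); exact: proj1_sig_inj.
have [|b bP] := rS (c := fun y : {y | (F `\ x) y} => w (proj1_sig y))
    (P := fun y => edge a (v (proj1_sig y))) sF.
  by move=> [y Fy] [z Fz] /=; have [e _] := vw y z Fy Fz; move=> /e ->.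
exists b => t u Ft Fu; rewrite /update.
have na' y : F y -> y <> x -> a <> v y by move=> Fy yx e; apply: na; exists y.
have bP' y (Fy : F y) (yx : y <> x) : (edge b (w y) <-> edge a (v y)) /\ b <> w y.
  exact: (bP (exist _ y (conj Fy yx))).
case: (eqVneq t x) => [_|/eqP tx]; case: (eqVneq u x) => [_|/eqP ux].
- by split; split=> // /iS.
- have [e ne] := bP' u Fu ux; have ne' := na' u Fu ux.
  by split; [split=> [/ne'|/ne] | exact: iff_sym].
- have [e ne] := bP' t Ft tx; have ne' := na' t Ft tx.
  split; first by split=> /esym; [move/ne' | move/ne].
  by split=> /sS/e/sS.
- exact: vw.
Qed.

Lemma term_var (t : term L) : exists x, t = Var L x.
Proof. by case: t => [x|[]]; exists x. Qed.

(* Quantifier elimination, in semantic form. *)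
Lemma same_type_value (phi : formula L) (v w : nat -> S) :
  same_type (free_vars phi) v w -> value v phi = value w phi.
Proof.
have [pS dS01 dSE _ _] := dS.
have sub (F : set nat) v' w' x (g : (nat -> S) -> R) : same_type (F `\ x) v' w' ->
    (forall v w, same_type F v w -> g v = g w) ->
    [set g (update v' x a) | a in [set: S]] `<=` [set g (update w' x a) | a in [set: S]].
  move=> vw H _ [a _ <-]; have [b ab] := same_type_extend a vw.
  by exists b => //; apply/esym/H.
elim: phi v w => [p ts|t u|n c phis IH|x psi IH|x psi IH] v w vw /=.
- case: p ts vw => ts vw.
  rewrite [in LHS](pair_funE (fun i => term_val v (ts i))).
  rewrite [in RHS](pair_funE (fun i => term_val w (ts i))).
  have [x tx] := term_var (ts ord0); have [y ty] := term_var (ts ord_max).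
  have [|| _ e] := vw x y; [by exists ord0; rewrite ?tx|by exists ord_max; rewrite ?ty|].
  rewrite tx ty /=; have [H1|H1] := pS (pair_fun (v x) (v y)).
    by rewrite H1; apply/esym/e.
  have [H2|H2] := pS (pair_fun (w x) (w y)); last by rewrite H1.
  by have := e.2 H2; rewrite /edge H1 => /eqP; rewrite oner_eq0.
- have [x tx] := term_var t; have [y ty] := term_var u.
  rewrite tx ty /= in vw *; have [|| e _] := vw x y; [by left|by right|].
  have [H1|H1] := dS01 (v x) (v y).
    by rewrite H1; apply/esym/dSE/e/dSE.
  have [H2|H2] := dS01 (w x) (w y); last by rewrite H1.
  by have := (dSE _ _).2 (e.2 ((dSE _ _).1 H2)); rewrite H1 => /eqP; rewrite oner_eq0.
- congr (c _); apply/rowP => i; rewrite !mxE; apply: IH => x y xi yi.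
  by apply: vw; exists i.
- by congr sup; apply/seteqP; split; apply: sub IH => //; exact: same_type_sym.
- by congr inf; apply/seteqP; split; apply: sub IH => //; exact: same_type_sym.
Qed.

Section Realize.
Variables (A : set S) (sA : small I {a | A a}).
Variables (W : set_system (nat -> S)) (UW : UltraFilter W).

(* The points whose type is prescribed: parameters and variables. *)
Local Notation point := ({a | A a} + nat)%type.

Definition at_point (v : nat -> S) (p : point) : S :=
  match p with inl a => proj1_sig a | inr n => v n end.

Definition below (n : nat) : set point :=
  [set p | if p is inr k then (k < n)%N else True].

(* [v] realizes, on [F], the limit along [W] of the types of the valuations. *)
Definition realizes_on (F : set point) (v : nat -> S) : Prop :=
  forall p q, F p -> F q ->
    (at_point v p = at_point v q <-> W [set w | at_point w p = at_point w q]) /\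
    (edge (at_point v p) (at_point v q) <->
       W [set w | edge (at_point w p) (at_point w q)]).

Lemma at_point_update v n a p : below n p ->
  at_point (update v n a) p = at_point v p.
Proof. by case: p => //= k kn; rewrite /update ltn_eqF. Qed.

Lemma below_last n p : below n.+1 p -> below n p \/ p = inr n.
Proof.
case: p => [a|k]; first by left.
by rewrite /below /= ltnS leq_eqVlt => /orP[/eqP ->|]; [right|left].
Qed.

(** If [w n] equals an earlier point for most [w], the value of [v] at that point is reused;
    otherwise richness supplies a new vertex with the edges that hold for most [w]. *)
Lemma realizes_on_extend n v : realizes_on (below n) v ->
  exists a, realizes_on (below n.+1) (update v n a).
Proof.
move=> vP; have [_ _ _ sS iS] := dS.
have [[t [tn Wt]]|nt] :=
    pselect (exists t, below n t /\ W [set w | w n = at_point w t]).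
  exists (at_point v t) => p q.
  pose f (p : point) : point := if p is inr k then if k == n then t else p else p.
  have fP s : below n.+1 s -> [/\ below n (f s),
      at_point (update v n (at_point v t)) s = at_point v (f s) &
      W [set w | at_point w s = at_point w (f s)]].
    case: s => [a _|k]; first by split=> //; exact: filterS filterT.
    rewrite /= /update; case: (eqVneq k n) => [->|kn]; first by [].
    rewrite ltnS leq_eqVlt (negbTE kn) /= => ltkn; split=> //; exact: filterS filterT.
  move=> /fP[fp -> Wp] /fP[fq -> Wq]; have [e1 e2] := vP _ _ fp fq.
  by split; [rewrite e1|rewrite e2]; split; apply: filterS3 Wp Wq => w /= -> ->.
have sF : small I {p | below n p}.
  have [f fi] := small_sum Iinf sA (small_nat Iinf).
  by exists (fun p => f (proj1_sig p)) => p q /fi /proj1_sig_inj.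
have [|z zP] := rS (c := fun p : {p | below n p} => at_point v (proj1_sig p))
    (P := fun p => W [set w | edge (w n) (at_point w (proj1_sig p))]) sF.
  move=> [p pn] [q qn] /=; have [e _] := vP p q pn qn.
  by move=> /e; apply: filterS2 => w /= ->.
exists z => p q.
have zP' s (sn : below n s) := zP (exist _ s sn).
have nW s : below n s -> ~ W [set w | w n = at_point w s].
  by move=> sn Ws; apply: nt; exists s.
have zn : at_point (update v n z) (inr n) = z by rewrite /= /update eqxx.
move=> /below_last[pn|->] /below_last[qn|->].
- by rewrite !at_point_update //; exact: vP.
- rewrite zn at_point_update //=; have [e ne] := zP' p pn; split; split.
  + by move/esym.
  + by move=> H; exfalso; apply: (nW p pn); apply: filterS H => w /= ->.
  + by move=> /sS/e; apply: filterS => w /=; exact: sS.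
  + by move=> H; apply/sS/e; apply: filterS H => w /=; exact: sS.
- rewrite zn at_point_update //=; have [e ne] := zP' q qn; split=> //.
  by split=> // /(nW q qn).
- rewrite zn /=; split; split=> //.
  + by move=> _; exact: filterS filterT.
  + by move/iS.
  + by move=> /filter_ex[w /iS].
Qed.

Lemma realizes_on_all : exists v, realizes_on setT v.
Proof.
case: (carrier_inhabited S) => a0.
have /choice[g gP] : forall p : nat * (nat -> S), exists a,
    realizes_on (below p.1) p.2 -> realizes_on (below p.1.+1) (update p.2 p.1 a).
  move=> [n v]; have [vP|nv] := pselect (realizes_on (below n) v); last by exists a0.
  by have [a aP] := realizes_on_extend vP; exists a.
(* Stage [n.+1] changes only coordinate [n], so the diagonal [V k.+1 k] is the final value. *)
pose V := fix V n := if n is n'.+1 then update (V n') n' (g (n', V n')) else fun=> a0.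
have VP n : realizes_on (below n) (V n).
  elim: n => [|n IH]; last exact: gP (n, V n) IH.
  (* At stage 0 only parameters occur, and their relations do not depend on the valuation. *)
  move=> [a|k] [b|m] //= _ _; split; apply: iff_sym; exact: ultra_const.
have VE n k : (k < n)%N -> V n k = V k.+1 k.
  elim: n => // n IH; rewrite ltnS leq_eqVlt => /orP[/eqP -> //|kn].
  by rewrite -IH //= /update ltn_eqF.
exists (fun k => V k.+1 k) => p q _ _.
have [n [pn qn]] : exists n, below n p /\ below n q.
  pose h (p : point) := if p is inr k then k.+1 else 0%N.
  exists (maxn (h p) (h q)); rewrite /below /h.
  by case: (p) => [a|k]; case: (q) => [b|m] //=; rewrite ?leq_max ?leqnn ?orbT.
have E s : below n s -> at_point (fun k => V k.+1 k) s = at_point (V n) s.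
  by case: s => //= k kn; rewrite VE.
by rewrite !E //; exact: VP.
Qed.

End Realize.

(** Finite satisfiability gives an ultrafilter [W] containing the solution set of every member of
    [G], and [v] realizes the limit type. For each member, some solution has the type of [v] on the
    finitely many relevant points, and quantifier elimination transfers the value 0. *)
Lemma rich_succ_saturated : succ_saturated S I.
Proof.
move=> A cA G GA Gfin.
have sA := small_card_le cA.
pose sat G0 := [set v : nat -> S | forall q, G0 q -> pvalue v q = 0].
have [W [UW WP]] : exists W, UltraFilter W /\
    filter_from [set G0 | finite_set G0 /\ G0 `<=` G] sat `<=` W.
  apply: ultraFilterLemma; apply: filter_from_proper; last first.
    by move=> G0 [G0f G0G]; exact: Gfin.
  apply: filter_from_filter; first by exists set0; split.
  move=> G0 G1 [G0f G0G] [G1f G1G]; exists (G0 `|` G1).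
    by split; [rewrite finite_setU | move=> q [/G0G|/G1G]].
  by move=> v H; split=> q Gq; apply: H; [left|right].
have Wsat q : G q -> W [set v | pvalue v q = 0].
  move=> Gq; apply: WP; exists [set q]; first by split=> // _ ->.
  by move=> v /(_ q erefl).
have [v vP] := realizes_on_all sA UW.
exists v => -[phi rho] Gq.
have /choice[point pointE] : forall x, exists p : {a | A a} + nat,
    forall w : nat -> S, odflt (w x) (rho x) = at_point w p.
  move=> x; case E : (rho x) => [a|]; last by exists (inr x).
  by exists (inl (exist _ a (GA _ Gq x a E))).
have [k kP] := free_vars_bound phi.
have H x y : W [set w |
    (at_point v (point x) = at_point v (point y) <->
     at_point w (point x) = at_point w (point y)) /\
    (edge (at_point v (point x)) (at_point v (point y)) <->
     edge (at_point w (point x)) (at_point w (point y)))].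
  have [-> ->] := conj (propext (vP (point x) (point y) Logic.I Logic.I).1)
                       (propext (vP (point x) (point y) Logic.I Logic.I).2).
  have dec (P : set (nat -> S)) : W [set w | W P <-> P w].
    by case: (ultra_dec UW P) => WP'; apply: filterS (WP') => w Pw; split=> // WP'';
      move/(ultraN UW): WP'.
  exact: filterI (dec _) (dec _).
have {}H : W [set w | forall x y : 'I_k,
    (at_point v (point x) = at_point v (point y) <->
     at_point w (point x) = at_point w (point y)) /\
    (edge (at_point v (point x)) (at_point v (point y)) <->
     edge (at_point w (point x)) (at_point w (point y)))].
  by apply: filter_forall => x; apply: filter_forall => y; exact: H.
have [w [/= vw wq]] := filter_ex (filterI H (Wsat _ Gq)).
rewrite -wq; apply: same_type_value => x y /kP xk /kP yk /=.
by rewrite !pointE; exact: (vw (Ordinal xk) (Ordinal yk)).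
Qed.

End Saturate.

Theorem theorem9p7 (R : realType) (V : vocabulary R) (T : set (formula V)) :
  metric_theory T -> unstable T -> keisler_le (@T_rg R) T.
Proof.
move=> _ uT I D UD satT; have sep := unstable_separates uT satT.
have [Iinf regD _] := satT; split=> // N mN.
have dN := discrete_model mN.
apply: rich_succ_saturated => //; first by apply: discrete_ultrapower; case: mN.
apply: rich_ultrapower => //; [by case: mN | exact: extension_model].
Qed.
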